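(* There is a function $f:\mathbb{N}\to\mathbb{R}$ with $f(n)\to 0$ as $n\to\infty$ such that for every positive integer $n$ there exists a Latin square $L$ of order $n$ with $\mathrm{scs}(L)\ge n^2-(e+f(n))\,n^{5/3}$. (That is, there exists a Latin square $L$ of order $n$ with $\mathrm{scs}(L)\ge n^2-(e+o(1))n^{5/3}$.)
   Context: A Latin square of order $n$ is an $n\times n$ array with entries from $\{1,\dots,n\}$ in which each symbol occurs exactly once in each row and each column; it is identified with the set of triples $(i,j;k)$ such that symbol $k$ is in cell $(i,j)$. A partial Latin square is such an array with possibly empty cells in which each symbol occurs at most once in each row and column; its size is the number of filled cells. A partial Latin square $C\subseteq L$ is uniquely completable if $L$ is the only Latin square of order $n$ containing $C$. A critical set of $L$ is a uniquely completable $C\subseteq L$ no proper subset of which is uniquely completable. $\mathrm{scs}(L)$ denotes the size of the smallest critical set of $L$. *)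

(* Defs.v *)
(* Plain MathComp definitions; MathComp-Analysis is used only for the real
   number bound of the statement. *)
From mathcomp Require Import all_boot.

Set Implicit Arguments.
Unset Strict Implicit.
Unset Printing Implicit Defensive.

(* (i, j, k) reads "symbol k is in cell (i, j)"; rows, columns and symbols are
   numbered 0, ..., n - 1. *)
Notation triple n := ('I_n * 'I_n * 'I_n)%type.

(* The three conditions are indexed by a cell, by a row and a symbol, and by a
   column and a symbol.  Since a cell holds at most one symbol, the number of
   filled cells of C is #|C|. *)
Definition is_partial_latin (n : nat) (C : {set triple n}) : bool :=
  [&& [forall i, forall j, #|[set k | (i, j, k) \in C]| <= 1],
      [forall i, forall k, #|[set j | (i, j, k) \in C]| <= 1]
    & [forall j, forall k, #|[set i | (i, j, k) \in C]| <= 1]].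

Definition is_latin (n : nat) (L : {set triple n}) : bool :=
  [&& [forall i, forall j, #|[set k | (i, j, k) \in L]| == 1],
      [forall i, forall k, #|[set j | (i, j, k) \in L]| == 1]
    & [forall j, forall k, #|[set i | (i, j, k) \in L]| == 1]].

Definition latin_square (n : nat) := {L : {set triple n} | is_latin L}.

Definition uniquely_completable (n : nat) (L : latin_square n)
    (C : {set triple n}) : bool :=
  [&& is_partial_latin C, C \subset val L
    & [forall L' : latin_square n, (C \subset val L') ==> (L' == L)]].

Definition critical_set (n : nat) (L : latin_square n) (C : {set triple n}) :
    bool :=
  minset (uniquely_completable L) C.

Lemma sub_latin_partial (n : nat) (L : latin_square n) (C : {set triple n}) :
  C \subset val L -> is_partial_latin C.
Proof.
move=> /subsetP sCL; case/and3P: (valP L) => /forallP cL /forallP rL /forallP kL.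
apply/and3P; split; apply/forallP => a; apply/forallP => b.
- rewrite -(eqP (forallP (cL a) b)); apply/subset_leq_card/subsetP => x.
  by rewrite !inE; apply: sCL.
- rewrite -(eqP (forallP (rL a) b)); apply/subset_leq_card/subsetP => x.
  by rewrite !inE; apply: sCL.
- rewrite -(eqP (forallP (kL a) b)); apply/subset_leq_card/subsetP => x.
  by rewrite !inE; apply: sCL.
Qed.

Lemma card_latin (n : nat) (L : latin_square n) : #|val L| = n ^ 2.
Proof.
case/and3P: (valP L) => /forallP cL _ _.
have -> : #|val L| = \sum_p \sum_(k | (p, k) \in val L) 1.
  by rewrite pair_big_dep -sum1_card; apply: eq_bigl; case.
rewrite (eq_bigr (fun=> 1)) => [|[i j] _].
  by rewrite sum1_card card_prod card_ord.
by rewrite sum1dep_card; apply/eqP/(forallP (cL i)).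
Qed.

Lemma uniquely_completable_full (n : nat) (L : latin_square n) :
  uniquely_completable L (val L).
Proof.
apply/and3P; split => //; first exact: (@sub_latin_partial _ L).
apply/forallP => L'; apply/implyP => sLL'; rewrite eq_sym -val_eqE.
by rewrite eqEcard sLL' !card_latin leqnn.
Qed.

Lemma critical_set_exists (n : nat) (L : latin_square n) :
  exists m, [exists C : {set triple n}, critical_set L C && (#|C| == m)].
Proof.
have [C minC _] := minset_exists (uniquely_completable_full L).
by exists #|C|; apply/existsP; exists C; rewrite /critical_set minC eqxx.
Qed.

Definition scs (n : nat) (L : latin_square n) : nat :=
  ex_minn (critical_set_exists L).

(* Main.v *)
Require Import Defs.
From mathcomp Require Import all_boot all_order all_algebra all_fingroup.
From mathcomp Require Import complex.
From mathcomp Require Import all_classical all_reals all_analysis.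
From mathcomp Require Import ring lra zify.

(* Counting argument.  If every Latin square of order n had a critical set with
   at most n^2 - k cells, then every one of them would be determined by a set of
   n^2 - k cells together with its symbols there.  Bregman's inequality, applied
   row by row, bounds the number of partial Latin squares of a given shape with
   k holes, and there are 'C(n^2, k) shapes.  On the other hand the permanent of
   a d-regular 0/1 matrix of order n is at least (d/e)^n, so that there are at
   least (n!/e^n)^n Latin squares.  The terms n ln n! - n^2 cancel, and what is
   left is k (ln k - 5/3 ln n - 1) <= 2 n^(3/2), which fails as soon as
   k >= (e + eps) n^(5/3) and n is large.

   The lower bound on permanents is Gurvits' capacity argument: the directional
   derivatives of a product of linear forms with positive coefficients do not
   vanish on the right half-plane, hence are real rooted along positive
   directions, and eliminating one variable costs at most a factor e. *)

Import Order.TTheory GRing.Theory Num.Theory.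
Import numFieldNormedType.Exports.

Set Implicit Arguments.
Unset Strict Implicit.
Unset Printing Implicit Defensive.

Local Open Scope ring_scope.

(** * Permanents and their mixed versions *)

Lemma count_geq_ord n m : count (fun j : 'I_n => ~~ (j < m)%N) (index_enum 'I_n) = (n - m)%N.
Proof.
rewrite -sum1_count big_mkcond/=; elim: n => [|n IHn]; first by rewrite big_ord0 sub0n.
by rewrite big_ord_recr/= IHn; case: ltnP => /=; lia.
Qed.

Section Permanent.
Variable F : comNzRingType.

Definition per n (w : 'I_n -> 'I_n -> F) : F := \sum_(s : 'S_n) \prod_j w j (s j).

(** For [m <= n] this is (n - m)! times the derivative of the product of the coordinates of [v]
    along the first [m] rows of [A]. *)
Definition mixed_per n (m : nat) (A : 'I_n -> 'I_n -> F) (v : 'I_n -> F) : F :=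
  per (fun j => if (j < m)%N then A j else v).

Lemma eq_per n (w w' : 'I_n -> 'I_n -> F) : w =2 w' -> per w = per w'.
Proof. by move=> ww; apply: eq_bigr => s _; apply: eq_bigr => j _. Qed.

Lemma per_perm n (w : 'I_n -> 'I_n -> F) (u : 'S_n) :
  per (fun j => w (u j)) = per w.
Proof.
rewrite /per (reindex_inj (mulgI u))/=; apply: eq_bigr => s _.
rewrite [RHS](reindex_inj (@perm_inj _ u))/=; apply: eq_bigr => j _.
by rewrite permM.
Qed.

Lemma mixed_per_scale n m (A : 'I_n -> 'I_n -> F) v (x : F) :
  mixed_per m A (fun i => x * v i) = x ^+ (n - m) * mixed_per m A v.
Proof.
rewrite /mixed_per /per mulr_sumr; apply: eq_bigr => s _.
have -> : x ^+ (n - m) = \prod_(j < n | ~~ (j < m)%N) x.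
  by rewrite big_const_seq count_geq_ord iter_mulr_1.
rewrite [in LHS](bigID (fun j : 'I_n => (j < m)%N))/=.
rewrite [X in _ = _ * X](bigID (fun j : 'I_n => (j < m)%N))/= mulrCA; congr (_ * _).
  by apply: eq_bigr => j ->.
by rewrite -big_split; apply: eq_bigr => j /negbTE ->.
Qed.

Lemma mixed_per0 n (A : 'I_n -> 'I_n -> F) v :
  mixed_per 0 A v = n`!%:R * \prod_i v i.
Proof.
rewrite /mixed_per /per [in LHS](eq_bigr (fun=> \prod_i v i)) => [|s _].
  by rewrite sumr_const card_Sn mulr_natl.
by rewrite [RHS](reindex_inj (@perm_inj _ s)).
Qed.

End Permanent.

(** * Mixed permanents restricted to a line, as polynomials *)

Section PermanentLine.
Variable F : comNzRingType.

Lemma deriv_prod_seq (I : eqType) (r : seq I) (p : I -> {poly F}) : uniq r ->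
  (\prod_(j <- r) p j)^`() =
  \sum_(j <- r) (p j)^`() * \prod_(i <- r | i != j) p i.
Proof.
elim: r => [|a r IHr]; first by rewrite !big_nil derivC.
rewrite cons_uniq => /andP[ar ur]; rewrite !big_cons eqxx/= derivM (IHr ur).
congr (_ + _).
  congr (_ * _); rewrite [LHS]big_seq [RHS]big_seq_cond; apply: eq_bigl => i.
  by case: eqVneq => [->|_]; rewrite ?andbT// (negbTE ar).
rewrite mulr_sumr [LHS]big_seq [RHS]big_seq; apply: eq_bigr => j jr.
have aj : a != j by apply: contraNneq ar => ->.
by rewrite big_cons aj mulrCA.
Qed.

Definition mixed_line n m (A : 'I_n -> 'I_n -> F) (v c : 'I_n -> F) : {poly F} :=
  mixed_per m (fun j i => (A j i)%:P) (fun i => (v i)%:P + c i *: 'X).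

Lemma horner_mixed_line n m (A : 'I_n -> 'I_n -> F) v c t :
  (mixed_line m A v c).[t] = mixed_per m A (fun i => v i + t * c i).
Proof.
rewrite /mixed_line /mixed_per /per horner_sum; apply: eq_bigr => s _.
rewrite horner_prod; apply: eq_bigr => j _.
by case: ifP; rewrite !hornerE// mulrC.
Qed.

(** By the product rule, each of the n - m rows equal to [v] is in turn replaced by [A m];
    exchanging that row with row [m] shows that all these terms agree. *)
Lemma deriv_mixed_line n (m : 'I_n) (A : 'I_n -> 'I_n -> F) v :
  (mixed_line m A v (A m))^`().[0] = (n - m)%:R * mixed_per m.+1 A v.
Proof.
pose w (j i : 'I_n) := if (j < m)%N then A j i else v i.
pose repl (j j' : 'I_n) := if j' == j then A m else w j'.
have -> : (mixed_line m A v (A m))^`().[0] =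
    \sum_(j : 'I_n | ~~ (j < m)%N) per (repl j).
  rewrite /mixed_line /mixed_per /per raddf_sum horner_sum exchange_big/=.
  apply: eq_bigr => s _; rewrite deriv_prod_seq ?index_enum_uniq// horner_sum.
  rewrite [RHS]big_mkcond/=; apply: eq_bigr => j _.
  rewrite hornerM; case: (boolP (j < m)%N) => jm /=.
    by rewrite derivC horner0 mul0r.
  rewrite derivD derivC derivZ derivX add0r !hornerE.
  rewrite [in RHS](bigD1 j)//= /repl eqxx; congr (_ * _).
  rewrite horner_prod; apply: eq_bigr => i /negbTE ->.
  by rewrite /w; case: ifP; rewrite !hornerE.
rewrite (eq_bigr (fun=> mixed_per m.+1 A v)) => [|j jm].
  by rewrite big_const_seq count_geq_ord iter_addr addr0 mulr_natl.
rewrite /mixed_per -(per_perm _ (tperm m j)); apply: eq_per => i' i.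
rewrite /repl /w; case: tpermP => [->|->|im ij].
- by rewrite eqxx ltnSn.
- case: (eqVneq m j) => [->|mj]; first by rewrite ltnSn.
  rewrite ltnn [in RHS]ltnS [in RHS]leq_eqVlt (negbTE jm) orbF; case: eqP => // jm'.
  by move/eqP: mj; case; apply: val_inj.
- rewrite (introF eqP ij) [in RHS]ltnS [in RHS]leq_eqVlt.
  have -> : (i' == m :> nat) = false by apply/eqP => /val_inj.
  by rewrite /=; case: ifP.
Qed.

Lemma size_prod_linear (I : Type) (r : seq I) (P : pred I) (a b : I -> F) :
  (size (\prod_(j <- r | P j) ((a j)%:P + b j *: 'X))%R
     <= (count P r).+1)%N /\
  (\prod_(j <- r | P j) ((a j)%:P + b j *: 'X))`_(count P r) =
  \prod_(j <- r | P j) b j.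
Proof.
elim: r => [|i r [IHs IHc]]; first by rewrite !big_nil size_polyC oner_eq0 coefC.
rewrite !big_cons/=; case: (P i) => //=; split.
  apply: (leq_trans (size_polyMleq _ _)); rewrite add1n.
  have : (size ((a i)%:P + b i *: 'X)%R <= 2)%N.
    rewrite (leq_trans (size_polyD _ _))// geq_max (leq_trans (size_polyC_leq1 _))//.
    by rewrite (leq_trans (size_scale_leq _ _))// size_polyX.
  move: IHs; set x := size _; set y := size _; lia.
rewrite mulrDl coefD add1n coefCM nth_default// mulr0 add0r.
by rewrite -scalerAl coefZ coefXM/= IHc.
Qed.

(** For positive [A] and [c] this coefficient is positive, so for [m < n] the line polynomial is not
    constant. *)
Lemma coef_mixed_line n m (A : 'I_n -> 'I_n -> F) v c : (m <= n)%N ->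
  (mixed_line m A v c)`_(n - m) = mixed_per m A c.
Proof.
move=> mn; rewrite /mixed_line /mixed_per /per coef_sum.
apply: eq_bigr => s _; rewrite !(bigID (fun j : 'I_n => (j < m)%N) predT)/=.
rewrite (eq_bigr (fun j => (A j (s j))%:P)) => [|j ->//].
rewrite -rmorph_prod coefCM; congr (_ * _).
  by apply: eq_bigr => j ->.
rewrite [in LHS](eq_bigr (fun j => (v (s j))%:P + c (s j) *: 'X)) => [|j /negbTE ->//].
have [_] := size_prod_linear (index_enum 'I_n) (fun j : 'I_n => ~~ (j < m)%N)
  (fun j => v (s j)) (fun j => c (s j)).
by rewrite count_geq_ord => ->; apply: eq_bigr => j /negbTE ->.
Qed.

End PermanentLine.

(** * Stability and Gurvits' inequality *)

Lemma mixed_per_gt0 (F : numDomainType) n m (A : 'I_n -> 'I_n -> F) (v : 'I_n -> F) :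
  (forall j i, 0 < A j i) -> (forall i, 0 < v i) -> 0 < mixed_per m A v.
Proof.
move=> A0 v0; rewrite /mixed_per /per (bigD1 1%g)//= ltr_wpDr//.
  by rewrite sumr_ge0// => s _; rewrite prodr_ge0// => j _; case: ifP; rewrite ltW.
by rewrite prodr_gt0// => j _; case: ifP.
Qed.

Section Stability.
Variable F : numClosedFieldType.
Implicit Types (p : {poly F}) (t z : F).

Lemma deriv0_prod_XsubC (rs : seq F) : 0 \notin rs ->
  (\prod_(z <- rs) ('X - z%:P))^`().[0] =
  (\prod_(z <- rs) ('X - z%:P)).[0] * \sum_(z <- rs) - z^-1.
Proof.
elim: rs => [|z rs IHrs]; first by rewrite !big_nil derivC horner0 mulr0.
rewrite inE negb_or eq_sym => /andP[z0 /IHrs]; rewrite !big_cons.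
set q := \prod_(_ <- _) _ => qE.
by rewrite derivM derivXsubC mul1r !hornerE qE; field.
Qed.

(** Normalising the factorisation at 0 instead of at infinity makes p'(0)/p(0) the sum of the
    numbers -1/z over the roots. *)
Lemma closed_poly_factors p : p.[0] != 0 -> exists rs : seq F,
  [/\ forall z, z \in rs -> root p z, size p = (size rs).+1,
      forall t, p.[t] = p.[0] * \prod_(z <- rs) (1 - t / z)
    & p^`().[0] = p.[0] * \sum_(z <- rs) - z^-1].
Proof.
move=> p0; have [rs] := closed_field_poly_normal p.
move: (lead_coef p) => c pE.
have c0 : c != 0.
  by apply: contraNneq p0; rewrite pE => ->; rewrite scale0r horner0.
have rootE z : (z \in rs) = root p z by rewrite pE rootZ// root_prod_XsubC.
have rs0 : 0 \notin rs by rewrite rootE.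
exists rs; split => [z|||].
- by rewrite rootE.
- by rewrite [in LHS]pE size_scale// size_prod_XsubC.
- move=> t; rewrite pE !hornerZ -mulrA; congr (_ * _).
  rewrite !horner_prod -big_split/= !big_seq; apply: eq_bigr => z zrs.
  have z0 : z != 0 by apply: contraNneq rs0 => <-.
  by rewrite !hornerE; field.
- by rewrite [in LHS]pE derivZ hornerZ deriv0_prod_XsubC// mulrA -hornerZ -pE.
Qed.

Lemma Re_sum (I : Type) (r : seq I) (f : I -> F) :
  'Re (\sum_(i <- r) f i) = \sum_(i <- r) 'Re (f i).
Proof. exact: raddf_sum. Qed.

(** Every root z has negative real part, so every -1/z has positive real part. Their sum, which is
    nonempty, is p'(0)/p(0). *)
Lemma stable_deriv0 p : (1 < size p)%N ->
  (forall t, 0 <= 'Re t -> p.[t] != 0) -> p^`().[0] != 0.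
Proof.
move=> sp p_stable; have p0 : p.[0] != 0 by rewrite p_stable// raddf0.
have [rs [rs_root sz _ ->]] := closed_poly_factors p0.
rewrite mulf_neq0//; suff : 0 < 'Re (\sum_(z <- rs) - z^-1).
  by apply: contraTneq => ->; rewrite raddf0 ltxx.
rewrite Re_sum.
have Re_lt0 z : z \in rs -> 'Re z < 0.
  move=> /rs_root /rootP pz; have := p_stable z; rewrite pz eqxx.
  by rewrite real_ltNge ?real0 ?Creal_Re//; case: (0 <= 'Re z) => // /(_ isT).
case: rs sz Re_lt0 {rs_root} => [|z rs] sz Re_lt0; first by rewrite sz in sp.
have pos y : y \in z :: rs -> 0 < 'Re (- y^-1).
  move=> /Re_lt0 y0; rewrite raddfN/= ReV oppr_gt0 pmulr_llt0// invr_gt0 exprn_gt0//.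
  by rewrite normr_gt0; apply: contraTneq y0 => ->; rewrite raddf0 ltxx.
rewrite big_cons ltr_wpDr ?pos ?mem_head//.
by rewrite big_seq sumr_ge0// => y yrs; rewrite ltW// pos// inE yrs orbT.
Qed.

Variables (n : nat) (A : 'I_n -> 'I_n -> F).
Hypothesis A_gt0 : forall j i, 0 < A j i.

Lemma size_mixed_line (m : 'I_n) v : (1 < size (mixed_line m A v (A m)))%N.
Proof.
have : (mixed_line m A v (A m))`_(n - m) != 0.
  by rewrite coef_mixed_line ?gt_eqF ?mixed_per_gt0// ltnW.
apply: contraR; rewrite -leqNgt => s1; rewrite nth_default//.
by rewrite (leq_trans s1)// subn_gt0.
Qed.

(** Induction on [m]: the next mixed permanent is, up to a factor, the derivative at 0 along the
    direction [A m], and for Re t >= 0 the points v + t A m stay in the right half-plane, where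
    [stable_deriv0] gets its hypothesis. *)
Lemma mixed_per_stable m (v : 'I_n -> F) : (m <= n)%N ->
  (forall i, 0 < 'Re (v i)) -> mixed_per m A v != 0.
Proof.
elim: m v => [v _|m IHm v mn] Re_v.
  rewrite mixed_per0 mulf_neq0 ?pnatr_eq0 -?lt0n ?fact_gt0// prodf_seq_neq0.
  apply/allP => i _ /=; apply: contraTneq (Re_v i) => ->.
  by rewrite raddf0 ltxx.
pose m' := Ordinal mn.
suff : (n - m)%:R * mixed_per m.+1 A v != 0 by rewrite mulf_eq0 negb_or => /andP[].
rewrite -(deriv_mixed_line m'); apply: stable_deriv0 => [|t t0].
  exact: size_mixed_line.
rewrite horner_mixed_line; apply: IHm => [|i]; first exact: ltnW.
by rewrite raddfD/= ReMr ?gtr0_real// ltr_wpDr// mulr_ge0// ltW.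
Qed.

Lemma mixed_line_real_rooted (m : 'I_n) (y : 'I_n -> F) t : (forall i, 0 < y i) ->
  root (mixed_line m A y (A m)) t -> t < 0.
Proof.
move=> y0; rewrite /root horner_mixed_line => root_t.
have t_real : t \is Num.real.
  apply: contraLR root_t => /Creal_ImP/eqP Imt.
  (* For non-real [t] all the points y i + t A m i lie strictly on one side of the real axis.
     Multiplication by [u] turns this side into the right half-plane, and homogeneity carries the
     nonvanishing back. *)
  pose u : F := if 0 < 'Im t then - 'i else 'i.
  have : mixed_per m A (fun i => u * (y i + t * A m i)) != 0.
    apply: mixed_per_stable => [|i]; first exact: ltnW.
    have Im_lin : 'Im (y i + t * A m i) = 'Im t * A m i.
      by rewrite raddfD/= (Creal_ImP _ _) ?gtr0_real// add0r ImMr ?gtr0_real.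
    rewrite /u; case: ifPn => Imt0.
      by rewrite mulNr raddfN/= ReMil opprK Im_lin mulr_gt0.
    rewrite ReMil Im_lin -mulNr mulr_gt0// oppr_gt0.
    by rewrite real_ltNge ?real0 ?Creal_Im// le_eqVlt negb_or eq_sym Imt.
  by rewrite mixed_per_scale; apply: contraNneq => ->; rewrite mulr0.
rewrite real_ltNge ?real0//; apply: contraL root_t => t0.
apply: mixed_per_stable => [|i]; first exact: ltnW.
have gt0 : 0 < y i + t * A m i by rewrite ltr_wpDr// mulr_ge0// ltW.
by rewrite (Creal_ReP _ _) ?gtr0_real.
Qed.

End Stability.

Lemma rmorph_per (F G : comNzRingType) (f : {rmorphism F -> G}) n
    (w : 'I_n -> 'I_n -> F) :
  f (per w) = per (fun j i => f (w j i)).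
Proof.
rewrite /per rmorph_sum; apply: eq_bigr => s _; exact: rmorph_prod.
Qed.

Lemma map_mixed_line (F G : comNzRingType) (f : {rmorphism F -> G}) n m
    (A : 'I_n -> 'I_n -> F) v c :
  map_poly f (mixed_line m A v c) =
  mixed_line m (fun j i => f (A j i)) (fun i => f (v i)) (fun i => f (c i)).
Proof.
rewrite /mixed_line /mixed_per rmorph_per; apply: eq_per => j i.
case: ifP => _ /=; first by rewrite map_polyC.
by rewrite rmorphD/= map_polyC map_polyZ map_polyX.
Qed.

(** * The capacity argument over the reals *)

Section Gurvits.
Variables (R : realType) (n : nat) (A : 'I_n -> 'I_n -> R).
Hypothesis A_gt0 : forall j i, 0 < A j i.
Local Notation toC := (real_complex R).

(** With a = -1/z > 0 for each root z, the bound 1 + t a <= exp(t a) holds factor by factor, and the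
    exponents add up to t p'(0)/p(0). *)
Lemma real_rooted_growth (p : {poly R}) (t : R) :
  0 < p.[0] -> (forall z, root (map_poly toC p) z -> z < 0) -> 0 <= t ->
  p.[t] <= p.[0] * expR (t * (p^`().[0] / p.[0])).
Proof.
move=> p0 p_roots t0; pose pC := map_poly toC p.
have hornerC x : pC.[toC x] = toC p.[x] by exact: horner_map.
have pC0 : pC.[0] = toC p.[0] by rewrite -hornerC rmorph0.
have [|rs [rs_root _ pCt pC'0]] := @closed_poly_factors _ pC.
  by rewrite pC0 fmorph_eq0 gt_eqF.
pose a (z : R[i]) : R := complex.Re (- z^-1).
have aE z : z \in rs -> 0 < a z /\ - z^-1 = toC (a z).
  move=> /rs_root/p_roots; rewrite -invr_lt0 -oppr_gt0 /a => z0; split.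
    by move: z0; rewrite ltcE => /andP[].
  by rewrite RRe_real// gtr0_real.
have ptE : p.[t] = p.[0] * \prod_(z <- rs) (1 + t * a z).
  apply: complexI; rewrite -hornerC pCt pC0 rmorphM rmorph_prod.
  congr (_ * _); rewrite !big_seq; apply: eq_bigr => z /aE[_ az].
  by rewrite rmorphD/= rmorphM/= -az mulrN.
have p'0E : p^`().[0] = p.[0] * \sum_(z <- rs) a z.
  apply: complexI; rewrite rmorphM rmorph_sum -horner_map rmorph0 -deriv_map.
  rewrite pC'0 pC0; congr (_ * _); rewrite !big_seq; apply: eq_bigr => z /aE[_].
  by [].
rewrite ptE p'0E mulrAC divff ?gt_eqF// mul1r ler_pM2l// mulr_sumr expR_sum.
rewrite !big_seq; apply: ler_prod => z /aE[az _].
by rewrite expR_ge1Dx andbT addr_ge0// mulr_ge0// ltW.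
Qed.

Lemma mixed_per_growth (m : 'I_n) (y : 'I_n -> R) t :
  (forall i, 0 < y i) -> 0 <= t ->
  mixed_per m A (fun i => y i + t * A m i) <=
    mixed_per m A y *
    expR (t * ((n - m)%:R * mixed_per m.+1 A y / mixed_per m A y)).
Proof.
move=> y0 t0; rewrite -deriv_mixed_line -horner_mixed_line.
have h0 : mixed_per m A y = (mixed_line m A y (A m)).[0].
  rewrite horner_mixed_line; apply: eq_per => j i; case: ifP => // _.
  by rewrite mul0r addr0.
rewrite h0; apply: real_rooted_growth => //; first by rewrite -h0 mixed_per_gt0.
move=> z; rewrite map_mixed_line; by apply: mixed_line_real_rooted => [j i|i]; rewrite ltcR.
Qed.

(* The induction of Gurvits: [K] is the capacity of the initial product of
   linear forms, and it drops by at most a factor [e] when one variable is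
   eliminated. *)
Lemma mixed_per_capacity (K : R) : 0 <= K ->
  (forall x : 'I_n -> R, (forall l, 0 < x l) ->
     K * \prod_l x l <= \prod_i \sum_l x l * A l i) ->
  forall m, (m < n)%N -> forall x : 'I_n -> R, (forall l, 0 < x l) ->
  expR (- m%:R) * K * \prod_(l < n | ~~ (l < m)%N) x l <=
  mixed_per m A (fun i => \sum_(l < n | ~~ (l < m)%N) x l * A l i) / (n - m)`!%:R.
Proof.
move=> K0 capK; elim=> [|m IHm] mn x x0.
  rewrite oppr0 expR0 mul1r mixed_per0 subn0 mulrAC divff ?mul1r ?pnatr_eq0 -?lt0n ?fact_gt0//.
  exact: capK.
have {}IHm := IHm (ltnW mn); pose m' := Ordinal (ltnW mn).
have ltSE (l : 'I_n) : (~~ (l < m)%N && (l != m')) = ~~ (l < m.+1)%N.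
  by rewrite -val_eqE/= ltnS; lia.
pose y i := \sum_(l < n | ~~ (l < m.+1)%N) x l * A l i.
have y0 i : 0 < y i.
  rewrite /y (bigD1 (Ordinal mn)) ?ltnn//= ltr_wpDr ?mulr_gt0//.
  by rewrite sumr_ge0// => l _; rewrite mulr_ge0// ltW.
set X := \prod_(l < n | _) x l.
pose h := mixed_per m A y; pose h' := (n - m)%:R * mixed_per m.+1 A y.
have h0 : 0 < h by rewrite mixed_per_gt0.
have h'0 : 0 < h' by rewrite mulr_gt0 ?mixed_per_gt0// ltr0n subn_gt0 ltnW.
(* Since [h'] is the slope of the mixed permanent at [y] along [A m], this [t] makes the exponent in
   [mixed_per_growth] equal to 1: the step costs a factor e. *)
pose t := h / h'; have t0 : 0 < t by rewrite divr_gt0.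
have fact_pos k : 0 < k`!%:R :> R by rewrite ltr0n fact_gt0.
(* Coordinate [m] does not occur in the claim for m + 1, so it may be set to [t] in the induction
   hypothesis. *)
pose x' (l : 'I_n) := if l == m' then t else x l.
have := IHm x'; rewrite (bigD1 m') ?ltnn//= [x' m']ifT//.
have -> : \prod_(l < n | ~~ (l < m)%N && (l != m')) x' l = X.
  rewrite (eq_bigl _ _ ltSE); apply: eq_bigr => l; rewrite -ltSE => /andP[_ lm].
  by rewrite /x' (negbTE lm).
have x'0 l : 0 < x' l by rewrite /x'; case: ifP.
move=> /(_ x'0); rewrite ler_pdivlMr// => /le_trans.
have -> : mixed_per m A (fun i => \sum_(l < n | ~~ (l < m)%N) x' l * A l i)
    = mixed_per m A (fun i => y i + t * A m' i).
  apply: eq_bigr => s _; apply: eq_bigr => j _; case: ifP => // _.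
  rewrite (bigD1 m') ?ltnn//= [x' m']ifT// addrC; congr (_ + _).
  rewrite (eq_bigl _ _ ltSE); apply: eq_bigr => l; rewrite -ltSE => /andP[_ lm].
  by rewrite /x' (negbTE lm).
have th : t * (h' / h) = 1 by rewrite /t; field; rewrite !gt_eqF.
have growth : mixed_per m A (fun i => y i + t * A m' i) <= h * expR 1.
  by rewrite -th; exact: mixed_per_growth (ltW t0).
move=> /(_ _ growth) {growth}.
rewrite ler_pdivlMr//.
have -> : (n - m)`! = ((n - m) * (n - m.+1)`!)%N.
  by rewrite -[(n - m)%N]prednK ?subn_gt0 1?ltnW// factS subnS.
rewrite natrM => IH; rewrite -(ler_pM2l (expR_gt0 1)) -(ler_pM2l t0).
rewrite -natr1 opprD expRD.
have -> : t * (expR 1 * (expR (- m%:R) * expR (-1) * K * X * (n - m.+1)`!%:R)) =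
   expR (- m%:R) * K * (t * X) * (n - m.+1)`!%:R.
  rewrite [expR (- 1)]expRN; field; exact: lt0r_neq0 (expR_gt0 1).
have nm0 : 0 < (n - m)%:R :> R by rewrite ltr0n subn_gt0 ltnW.
rewrite -(ler_pM2l nm0).
have -> : (n - m)%:R * (t * (expR 1 * mixed_per m.+1 A y)) = h * expR 1.
  by rewrite /t /h'; field; rewrite ?(gt_eqF nm0) ?gt_eqF ?mixed_per_gt0//.
move: IH; rewrite -/t; lra.
Qed.

End Gurvits.

(** * Bregman's inequality *)

Lemma prod_expR_ln (R : realType) (I : finType) (f : I -> R) :
  (forall i, 0 < f i) -> \prod_i f i = expR (\sum_i ln (f i)).
Proof.
by move=> f0; rewrite expR_sum; apply: eq_bigr => i _; rewrite lnK ?posrE.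
Qed.

(** The tangent bound for the convex function x ln x, obtained from ln u <= u - 1 at u = m / c. The
    case c = 0 is included because fibre sizes and hole counts may vanish. *)
Lemma xlnx_tangent (R : realType) (c m : R) : 0 <= c -> 0 < m ->
  c - m <= c * ln c - c * ln m.
Proof.
rewrite le_eqVlt => /predU1P[<-|c0] m0.
  by rewrite sub0r !mul0r subrr oppr_le0 ltW.
rewrite -mulrBr -ln_div ?posrE//.
have : ln (m / c) <= m / c - 1.
  rewrite -[X in ln X](subrKC 1); apply: le_ln1Dx.
  by rewrite ltrBrDl subrr divr_gt0.
rewrite -(ler_pM2l c0) mulrBr mulr1 mulrCA divff ?gt_eqF// mulr1.
by rewrite !ln_div ?posrE// !mulrBr; lra.
Qed.

Definition count_perms n (a : rel 'I_n) : nat :=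
  #|[set s : 'S_n | [forall i, a i (s i)]]|.

Definition row_deg n (a : rel 'I_n) (i : 'I_n) : nat := (\sum_k a i k)%N.

Lemma row_degE n (a : rel 'I_n) i : row_deg a i = #|a i|.
Proof.
by rewrite -sum1_card big_mkcond; apply: eq_bigr => k _; rewrite unfold_in; case: (a i k).
Qed.

Definition minor_rel n (a : rel 'I_n.+1) (i k : 'I_n.+1) : rel 'I_n :=
  fun x y => a (lift i x) (lift k y).

Lemma row_deg_minor n (a : rel 'I_n.+1) i k x :
  row_deg (minor_rel a i k) x = (row_deg a (lift i x) - a (lift i x) k)%N.
Proof. by rewrite /row_deg [in RHS](bigD1_ord k)//= addnC addnK. Qed.

Lemma lift_perm_surj n (i k : 'I_n.+1) (s : 'S_n.+1) :
  s i = k -> exists t, s = lift_perm i k t.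
Proof.
move=> sik; have /fin_all_exists[u uE] x : exists y, s (lift i x) = lift k y.
  have := neq_lift i x; rewrite -(can_eq (permK s)) sik.
  by move=> /unlift_some[y -> _]; exists y.
have u_inj : injective u.
  by move=> x y /(congr1 (lift k)); rewrite -!uE => /perm_inj/lift_inj.
exists (perm u_inj); apply/permP => x.
case: (unliftP i x) => [y|] ->; last by rewrite lift_perm_id.
by rewrite lift_perm_lift permE uE.
Qed.

Lemma count_perms_fiber n (a : rel 'I_n.+1) i k :
  (#|[set s : 'S_n.+1 | [forall j, a j (s j)] & s i == k]|
     <= count_perms (minor_rel a i k))%N.
Proof.
apply: leq_trans (leq_imset_card (lift_perm i k) _).
apply/subset_leq_card/fintype.subsetP => s; rewrite inE => /andP[/forallP as_ /eqP sik].
have [t st] := lift_perm_surj sik; apply/imsetP; exists t => //.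
rewrite inE; apply/forallP => x; have := as_ (lift i x).
by rewrite st lift_perm_lift.
Qed.

Section Bregman.
Variable R : realType.

(** The logarithm of Bregman's factor d!^(1/d), with value 0 at d = 0. *)
Definition bregman_weight (d : nat) : R := ln d`!%:R / d%:R.

Lemma bregman_weight_ge0 d : 0 <= bregman_weight d.
Proof. by rewrite divr_ge0// ln_ge0// ler1n fact_gt0. Qed.

Lemma natr_mul_bregman_weight d : d%:R * bregman_weight d = ln d`!%:R.
Proof.
case: d => [|d]; first by rewrite mul0r fact0 ln1.
by rewrite mulrC divfK// pnatr_eq0.
Qed.

(** Jensen's inequality for x ln x: sum the tangent bounds taken at the mean of the [t i]. *)
Lemma sum_xlnx_ge (I : finType) (P : pred I) (t : I -> R) :
  (forall i, P i -> 0 <= t i) -> 0 < \sum_(i | P i) t i ->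
  (\sum_(i | P i) t i) * ln (\sum_(i | P i) t i)
    <= (\sum_(i | P i) t i) * ln #|P|%:R + \sum_(i | P i) t i * ln (t i).
Proof.
move=> t0; set N := \sum_(i | P i) t i => N0.
have P0 : 0 < #|P|%:R :> R.
  rewrite ltr0n lt0n; apply: contraTneq N0 => /card0_eq P0.
  by rewrite /N big_pred0 ?ltxx// => i; have := P0 i.
have : \sum_(i | P i) (t i - N / #|P|%:R)
    <= \sum_(i | P i) (t i * ln (t i) - t i * ln (N / #|P|%:R)).
  by apply: ler_sum => i /t0 ti; apply: xlnx_tangent => //; exact: divr_gt0.
rewrite !sumrB -/N sumr_const -[_ *+ #|_|]mulr_natr divfK ?gt_eqF// subrr.
by rewrite -mulr_suml -/N ln_div ?posrE// mulrBr; lra.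
Qed.

(** Collect the terms by row. A row of degree r loses an entry in r - 1 of the minors obtained by
    deleting another row and keeps its degree in n + 1 - r of them. Since ln r + ln (r - 1)! = ln
    r!, its total is n + 1 times its weight. *)
Lemma bregman_step n (a : rel 'I_n.+1) (s : 'S_n.+1) :
  (forall i, a i (s i)) ->
  \sum_i (ln (row_deg a i)%:R +
      \sum_x bregman_weight (row_deg (minor_rel a i (s i)) x))
    = n.+1%:R * \sum_i bregman_weight (row_deg a i).
Proof.
move=> as_; pose G (i j : 'I_n.+1) : R :=
  bregman_weight (row_deg a j - a j (s i))%N.
have GE i : \sum_x bregman_weight (row_deg (minor_rel a i (s i)) x)
    = \sum_j G i j - bregman_weight (row_deg a i).-1.
  rewrite [in RHS](bigD1_ord i)//= {1}/G as_ subn1 addrAC subrr add0r.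
  by apply: eq_bigr => x _; rewrite row_deg_minor.
under eq_bigr do rewrite GE addrA addrAC.
rewrite big_split/= exchange_big/= -big_split/= mulr_sumr.
apply: eq_bigr => j _.
have r0 : (0 < row_deg a j)%N by rewrite /row_deg (bigD1 (s j))//= as_.
have -> : \sum_i G i j = (row_deg a j)%:R * bregman_weight (row_deg a j).-1
    + (n.+1%:R - (row_deg a j)%:R) * bregman_weight (row_deg a j).
  transitivity (\sum_k ((a j k)%:R * bregman_weight (row_deg a j).-1 +
      (1 - (a j k)%:R) * bregman_weight (row_deg a j))).
    rewrite [RHS](reindex_inj (@perm_inj _ s))/=; apply: eq_bigr => i _.
    rewrite /G; case: (a j (s i)); first by rewrite subn1 subrr mul1r mul0r addr0.
    by rewrite subn0 subr0 mul1r mul0r add0r.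
  rewrite big_split/= -!mulr_suml sumrB sumr_const card_ord natr_sum.
  by rewrite -[1 *+ _]/(n.+1%:R).
have := natr_mul_bregman_weight (row_deg a j).-1.
have := natr_mul_bregman_weight (row_deg a j).
case: (row_deg a j) r0 => // d _ /=.
rewrite factS natrM lnM ?posrE ?ltr0n ?fact_gt0// -natr1.
set w := bregman_weight d; set w1 := bregman_weight d.+1; set x := ln _; set y := ln _.
by move=> *; nra.
Qed.

(* Schrijver's proof: expanding along every row i at once, the factor
   [ln t_ik] is charged to each of the [t_ik] permutations mapping [i] to [k]. *)
Theorem bregman n (a : rel 'I_n) :
  ln (count_perms a)%:R <= \sum_i bregman_weight (row_deg a i).
Proof.
elim: n a => [|n IHn] a.
  rewrite big_ord0 ln_le0// lern1 (leq_trans (max_card _))//.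
  by rewrite card_Sn.
have [N0|N_gt0] := posnP (count_perms a).
  by rewrite N0 ln0// sumr_ge0// => i _; exact: bregman_weight_ge0.
pose S := [set s : 'S_n.+1 | [forall i, a i (s i)]].
pose t i k := #|[set s : 'S_n.+1 | [forall j, a j (s j)] & s i == k]|.
set N := (count_perms a)%:R; have {}N_gt0 : 0 < N by rewrite ltr0n.
have part (i : 'I_n.+1) (F : 'S_n.+1 -> R) : \sum_(s in S) F s =
    \sum_(k | a i k) \sum_(s in [set s : 'S_n.+1 | [forall j, a j (s j)] & s i == k]) F s.
  rewrite (partition_big (fun s : 'S_n.+1 => s i) (a i)) => [|s]; last first.
    by rewrite inE => /forallP.
  by apply: eq_bigr => k _; apply: eq_bigl => s; rewrite !inE.
have sumt i : \sum_(k | a i k) (t i k)%:R = N.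
  rewrite /N /count_perms -sum1_card natr_sum (part i); apply: eq_bigr => k _.
  by rewrite -natr_sum sum1_card.
(* Convexity bounds N ln N by N ln r plus the sum of the t_ik ln t_ik, where r is the degree of row
   [i]; the latter sum is spread over the permutations of each fibre. *)
have row_ineq i : N * ln N <=
    \sum_(s in S) (ln (row_deg a i)%:R + ln (t i (s i))%:R).
  have := @sum_xlnx_ge _ (a i) (fun k => (t i k)%:R).
  rewrite sumt => /(_ (fun _ _ => ler0n _ _) N_gt0) /le_trans; apply.
  rewrite big_split/= sumr_const -[_ *+ #|S|]mulr_natl lerD//.
    by rewrite row_degE.
  rewrite (part i); apply: ler_sum => k _.
  rewrite (eq_bigr (fun=> ln (t i k)%:R)) => [|s]; last first.
    by rewrite inE => /andP[_ /eqP ->].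
  by rewrite sumr_const mulr_natl.
(* Summing over all n + 1 rows leaves, for each permutation separately, the quantity evaluated by
   [bregman_step]. *)
rewrite -(ler_pM2l N_gt0) -(@ler_pM2l _ n.+1%:R) ?ltr0n//.
have -> : n.+1%:R * (N * ln N) = \sum_(i < n.+1) N * ln N.
  by rewrite sumr_const card_ord mulr_natl.
apply: (le_trans (ler_sum _ (fun i _ => row_ineq i))).
rewrite exchange_big/= mulrCA mulr_natl -sumr_const.
apply: ler_sum => s sS; have as_ : forall i, a i (s i).
  by move: sS; rewrite inE => /forallP.
rewrite -(bregman_step as_) ler_sum// => i _; rewrite lerD2l.
(* The fibre is at most the count for the minor, to which the induction hypothesis applies; [s]
   itself shows that the fibre is nonempty. *)
apply: le_trans (IHn _); rewrite ler_ln ?posrE ?ler_nat ?count_perms_fiber//.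
  by rewrite ltr0n card_gt0; apply/set0Pn; exists s; rewrite inE eqxx andbT; apply/forallP.
rewrite ltr0n; apply: leq_trans (count_perms_fiber a i (s i)).
by rewrite card_gt0; apply/set0Pn; exists s; rewrite inE eqxx andbT; apply/forallP.
Qed.

End Bregman.

(** * Permanents of regular 0/1 matrices *)

Section DoublyStochastic.
Variables (R : realType) (n : nat) (A : 'I_n -> 'I_n -> R) (s : R).
Hypothesis A_gt0 : forall j i, 0 < A j i.
Hypothesis s_gt0 : 0 < s.
Hypothesis row_sum : forall j, \sum_i A j i = s.
Hypothesis col_sum : forall i, \sum_j A j i = s.

(* Weighted AM-GM in each column, multiplied over the columns. *)
Lemma doubly_stochastic_capacity (x : 'I_n -> R) : (forall l, 0 < x l) ->
  s ^+ n * \prod_l x l <= \prod_i \sum_l x l * A l i.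
Proof.
move=> x0; pose M i := \sum_l x l * A l i.
have M0 i : 0 < M i.
  by rewrite /M (bigD1 i)//= ltr_wpDr ?mulr_gt0// sumr_ge0// => l _; rewrite mulr_ge0// ltW.
have col i : \sum_l A l i * ln (x l) <= s * (ln (M i) - ln s).
  have : \sum_l A l i * (ln (x l) - (ln (M i) - ln s)) <=
      \sum_l A l i * (x l / (M i / s) - 1).
    apply: ler_sum => l _; rewrite ler_pM2l//.
    rewrite -ln_div ?posrE// -ln_div ?posrE ?divr_gt0//.
    rewrite -[X in ln X](subrKC 1); apply: le_ln1Dx.
    by rewrite ltrBrDl subrr !divr_gt0.
  have -> : \sum_l A l i * (x l / (M i / s) - 1) = 0.
    under eq_bigr do rewrite mulrBr mulr1 mulrA [A _ _ * _]mulrC.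
    by rewrite sumrB -mulr_suml col_sum -/(M i); field; rewrite !gt_eqF.
  under eq_bigr do rewrite mulrBr.
  by rewrite sumrB -mulr_suml col_sum subr_le0.
have : \sum_l s * ln (x l) <= \sum_i s * (ln (M i) - ln s).
  apply: le_trans (ler_sum _ (fun i _ => col i)); rewrite exchange_big/=.
  by apply: ler_sum => l _; rewrite -mulr_suml row_sum.
rewrite -!mulr_sumr ler_pM2l// sumrB sumr_const card_ord lerBrDr => lnle.
rewrite (prod_expR_ln x0) (prod_expR_ln M0) -[in s ^+ n](lnK (_ : s \is Num.pos)) ?posrE//.
by rewrite -expRM_natl -expRD ler_expR addrC mulr_natl.
Qed.

(** The capacity bound is used at index n - 1 with all variables 1: one free row remains there, and
    the mixed permanent is the permanent itself. *)
Lemma per_ge : expR (- n%:R) * s ^+ n <= per A.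
Proof.
case: n A A_gt0 row_sum col_sum doubly_stochastic_capacity => [|m] B B0 _ _ cap.
  rewrite expr0 mulr1 oppr0 expR0 /per (bigD1 1%g)//= big_ord0 lerDl.
  by rewrite sumr_ge0// => u _; rewrite big_ord0.
have := mixed_per_capacity B0 (exprn_ge0 m.+1 (ltW s_gt0)) cap (ltnSn m).
move=> /(_ (fun=> 1) (fun=> ltr01)); rewrite subSnn -[(1`!)%N]/(1%N) divr1 big1 ?mulr1//.
have -> : mixed_per m B (fun i => \sum_(l < m.+1 | ~~ (l < m)%N) 1 * B l i) = per B.
  apply: eq_per => j i; case: ifPn => // jm.
  have lE (l : 'I_m.+1) : ~~ (l < m)%N = (l == j).
    by rewrite -val_eqE/=; have := ltn_ord l; have := ltn_ord j; lia.
  by rewrite (eq_bigl _ _ lE) big_pred1_eq mul1r.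
apply: le_trans; apply: ler_wpM2r; first by rewrite exprn_ge0// ltW.
by rewrite ler_expR lerN2 ler_nat leqnSn.
Qed.

End DoublyStochastic.

(** A crude error term, enough to let [e] tend to 0. With T the power for the tail, each new factor
    adds at most three terms bounded by e T, whence the base 3. *)
Lemma prod_perturb_le (R : realDomainType) (I : Type) (r : seq I) (b : I -> R) (e : R) :
  (forall i, 0 <= b i <= 1) -> 0 <= e <= 1 ->
  [/\ 0 <= \prod_(i <- r) b i, \prod_(i <- r) b i <= 1 &
     \prod_(i <- r) (b i + e) <= \prod_(i <- r) b i + e * 3 ^+ size r].
Proof.
move=> b01 /andP[e0 e1]; elim: r => [|i r [IH0 IH1 IHr]].
  by rewrite !big_nil; split => //; rewrite expr0 mulr1 lerDl.
rewrite !big_cons/= exprS; have /andP[bi0 bi1] := b01 i.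
have t1 : 1 <= 3 ^+ size r :> R by rewrite exprn_ege1// ler1n.
set P := \prod_(_ <- _) b _ in IH0 IH1 IHr *; set Q := \prod_(_ <- _) _ in IHr *.
set T := 3 ^+ size r in t1 IHr *; split; [exact: mulr_ge0|exact: mulr_ile1|].
have : (b i + e) * Q <= (b i + e) * (P + e * T) by rewrite ler_wpM2l// addr_ge0.
move=> /le_trans; apply.
have H1 : b i * (e * T) <= e * T.
  by rewrite ler_piMl// mulr_ge0// (le_trans ler01).
have H2 : e * P <= e * T by rewrite ler_wpM2l// (le_trans IH1).
have H3 : e * (e * T) <= e * T by rewrite ler_piMl// mulr_ge0// (le_trans ler01).
by rewrite mulrDl !mulrDr; lra.
Qed.

(** A 0/1 matrix may have zero entries, while the capacity argument wants positive ones. Adding [e]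
    to every entry keeps all line sums equal, to k + n e, and the bound passes to the limit e =
    0. *)
Theorem count_perms_regular_ge (R : realType) n k (a : rel 'I_n) :
  (forall j, row_deg a j = k) -> (forall i, (\sum_j a j i)%N = k) ->
  expR (- n%:R) * k%:R ^+ n <= (count_perms a)%:R :> R.
Proof.
move=> row col; pose A (e : R) (j i : 'I_n) := (a j i)%:R + e.
have perA0 : per (A 0) = (count_perms a)%:R.
  rewrite /per /count_perms -sum1_card natr_sum [RHS]big_mkcond/=; apply: eq_bigr => s _.
  rewrite inE; case: ifPn => [/forallP as_|/forallPn[j /negbTE aj]].
    by rewrite big1// => j _; rewrite /A as_ addr0.
  by rewrite (bigD1 j)//= /A aj addr0 mul0r.
pose C : R := \sum_(s : 'S_n) 3 ^+ n.
have C0 : 0 <= C by rewrite sumr_ge0// => s _; rewrite exprn_ge0.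
have perA e : 0 <= e <= 1 -> per (A e) <= per (A 0) + e * C.
  move=> e01; rewrite /C mulr_sumr -big_split; apply: ler_sum => s _.
  pose b j : R := (a j (s j))%:R.
  have b01 j : 0 <= b j <= 1 by rewrite /b; case: (a j _); rewrite ?ler01 ?lexx.
  have [_ _] := prod_perturb_le (index_enum 'I_n) b01 e01.
  rewrite [index_enum _]unlock -enumT size_enum_ord => /le_trans; apply.
  rewrite lerD2r le_eqVlt; apply/orP; left; apply/eqP.
  by apply: eq_bigr => j _; rewrite /A addr0.
have lower e : 0 < e -> expR (- n%:R) * k%:R ^+ n <= per (A e).
  move=> e0; have [n0|n0] := posnP n.
    move: (k) (a) (A e) row col perA0 => ? ? w _ _ _ {perA}; subst n.
    rewrite expr0 mulr1 oppr0 expR0 /per (bigD1 1%g)//= big_ord0 lerDl.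
    by rewrite sumr_ge0// => u _; rewrite big_ord0.
  have A0 j i : 0 < A e j i by rewrite ltr_wpDl.
  have s0 : 0 < k%:R + e *+ n by rewrite ltr_wpDl// mulrn_wgt0.
  have rowA j : \sum_i A e j i = k%:R + e *+ n.
    by rewrite big_split/= sumr_const card_ord -natr_sum [X in X%:R]row.
  have colA i : \sum_j A e j i = k%:R + e *+ n.
    by rewrite big_split/= sumr_const card_ord -natr_sum [X in X%:R]col.
  apply: le_trans (per_ge A0 s0 rowA colA).
  rewrite ler_wpM2l ?expR_ge0//; apply: lerXn2r; rewrite ?nnegrE ?ler0n ?(ltW s0)//.
  by rewrite lerDl mulrn_wge0// ltW.
rewrite -perA0; apply/ler_addgt0Pr => e e0.
(* The perturbation then changes the permanent by at most [e]; C + 1 keeps the denominator positive,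
   and the minimum keeps [d] in the range of [perA]. *)
pose d := Num.min 1 (e / (C + 1)).
have d0 : 0 < d by rewrite lt_min ltr01 divr_gt0// ltr_wpDl.
have d1 : d <= 1 by rewrite ge_min lexx.
apply: le_trans (lower d d0) _; apply: le_trans (perA d _) _.
  by rewrite d1 ltW.
rewrite lerD2l; have : d <= e / (C + 1) by rewrite ge_min lexx orbT.
rewrite ler_pdivlMr ?ltr_wpDl// => /(le_trans _); apply.
by apply: ler_wpM2l; rewrite ?lerDl// ltW.
Qed.

(** * Counting arrays row by row *)

Lemma card_ltn_ord n m : (m <= n)%N -> #|[set i : 'I_n | (i < m)%N]| = m.
Proof.
move=> mn; rewrite -sum1dep_card -(big_ord_widen n (fun=> 1%N) mn).
by rewrite sum1_card card_ord.
Qed.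

Section RowPermutations.
Variable n : nat.
Local Notation all_cells := [set: 'I_n * 'I_n]%SET.
Implicit Types (S : {set 'I_n * 'I_n}) (sg : {ffun 'I_n -> 'S_n}).

(* The arrays of which only the first [m] rows are used (the others hold the
   dummy value 1), where each row is a permutation and where no symbol is
   repeated within a column among the cells of [S]. *)
Definition column_proper S (m : nat) : {set {ffun 'I_n -> 'S_n}} :=
  [set sg : {ffun 'I_n -> 'S_n} |
    [forall i : 'I_n, (m <= i)%N ==> (sg i == 1%g)] &&
    [forall i : 'I_n, forall i' : 'I_n, forall j,
      [&& (i < i')%N, (i' < m)%N, (i, j) \in S & (i', j) \in S] ==>
      (sg i j != sg i' j)]].

Definition available S (m : 'I_n) sg : rel 'I_n := fun j k =>
  ((m, j) \in S) ==>
    [forall i : 'I_n, ((i < m)%N && ((i, j) \in S)) ==> (sg i j != k)].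

Definition filled_above S (m : nat) (j : 'I_n) : nat :=
  #|[set i : 'I_n | (i < m)%N & (i, j) \in S]|.

Lemma column_properP S m sg :
  reflect ((forall i : 'I_n, (m <= i)%N -> sg i = 1%g) /\
     forall (i i' : 'I_n) j, (i < i')%N -> (i' < m)%N ->
       (i, j) \in S -> (i', j) \in S -> sg i j != sg i' j)
    (sg \in column_proper S m).
Proof.
rewrite inE; apply: (iffP andP) => [[/forallP triv /forallP prop]|[triv prop]].
  split=> [i mi|i i' j ii' i'm ij i'j]; first exact/eqP/(implyP (triv i)).
  have /forallP/(_ j)/implyP-> // := forallP (prop i) i'.
  by rewrite ii' i'm ij i'j.
split; first by apply/forallP => i; apply/implyP => /triv ->.
apply/forallP => i; apply/forallP => i'; apply/forallP => j.
by apply/implyP => /and4P[]; exact: prop.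
Qed.

Definition set_row sg (m : 'I_n) (s : 'S_n) : {ffun 'I_n -> 'S_n} :=
  [ffun i => if i == m then s else sg i].

Lemma set_row_proper S (m : 'I_n) sg (s : 'S_n) : sg \in column_proper S m ->
  (set_row sg m s \in column_proper S m.+1) = [forall j, available S m sg j (s j)].
Proof.
move=> /column_properP[triv prop]; apply/column_properP/forallP => [[_ prop'] j|av].
  apply/implyP => mj; apply/forallP => i; apply/implyP => /andP[im ij].
  have := prop' i m j im (ltnSn _) ij mj.
  by rewrite !ffunE eqxx ifN// -val_eqE/= ltn_eqF.
split=> [i mi|i i' j ii' i'm ij i'j]; rewrite !ffunE.
  by rewrite ifN ?triv// 1?ltnW// -val_eqE/= gtn_eqF.
move: i'm; rewrite ltnS leq_eqVlt => /predU1P[/val_inj i'm|i'm].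
  rewrite i'm eqxx ifN; last by rewrite -val_eqE/= ltn_eqF// -i'm.
  have /implyP := av j; rewrite -i'm i'j => /(_ isT)/forallP/(_ i)/implyP; apply.
  by rewrite ii'.
rewrite !ifN ?prop// -val_eqE/= ltn_eqF//; exact: ltn_trans ii' i'm.
Qed.

(** Resetting row [m] to the dummy 1 maps the arrays with m + 1 rows to those with m rows; each
    fibre consists of the permutations allowed by [available]. *)
Lemma card_column_properS S (m : 'I_n) :
  #|column_proper S m.+1| =
  (\sum_(sg in column_proper S m) count_perms (available S m sg))%N.
Proof.
pose forget sg := set_row sg m 1%g.
have forgetP sg : sg \in column_proper S m.+1 -> forget sg \in column_proper S m.
  move=> /column_properP[triv prop]; apply/column_properP; split.
    move=> i; rewrite leq_eqVlt ffunE => /predU1P[/val_inj ->|mi]; first by rewrite eqxx.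
    by rewrite triv//; case: ifP.
  move=> i i' j ii' i'm ij i'j; rewrite !ffunE !ifN ?prop//; first exact: leqW.
    by rewrite -val_eqE/= ltn_eqF.
  by rewrite -val_eqE/= ltn_eqF//; exact: ltn_trans ii' i'm.
rewrite -sum1_card (partition_big forget (fun sg => sg \in column_proper S m))//=.
apply: eq_bigr => sg sgX; rewrite sum1dep_card.
have sgK s : forget (set_row sg m s) = sg.
  apply/ffunP => i; rewrite !ffunE; case: eqP => // ->.
  by have /column_properP[->] := sgX.
rewrite /count_perms -(card_imset _ (_ : injective (set_row sg m))); last first.
  by move=> s t /ffunP/(_ m); rewrite !ffunE eqxx.
apply: eq_card => rh; rewrite inE; apply/andP/imsetP => [[rhX /eqP rhE]|[s]].
  have rhK : rh = set_row sg m (rh m).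
    apply/ffunP => i; rewrite -rhE !ffunE; case: eqP => // ->; by [].
  exists (rh m) => //; rewrite inE -set_row_proper//; by rewrite -rhK.
by rewrite inE -set_row_proper// => sX ->; rewrite sgK.
Qed.

(** The symbols already placed in column [j] within [S] are distinct, so each of these cells
    excludes one more symbol. *)
Lemma row_deg_available S (m : 'I_n) sg j : sg \in column_proper S m ->
  row_deg (available S m sg) j =
  if (m, j) \in S then (n - filled_above S m j)%N else n.
Proof.
move=> /column_properP[_ prop]; rewrite row_degE; case: ifPn => mj; last first.
  by rewrite -[RHS]card_ord; apply: eq_card => k; rewrite unfold_in /available (negbTE mj).
pose U := [set i : 'I_n | (i < m)%N & (i, j) \in S].
have U_inj : {in U &, injective (fun i : 'I_n => sg i j)}.
  move=> i i'; rewrite !inE => /andP[im ij] /andP[i'm i'j] eq_sg; apply/val_inj.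
  case: (ltngtP i i') => // lt.
    by have := prop i i' j lt i'm ij i'j; rewrite eq_sg eqxx.
  by have := prop i' i j lt im i'j ij; rewrite eq_sg eqxx.
rewrite /filled_above -/U -(card_in_imset U_inj) -[X in (X - _)%N]card_ord.
rewrite -(cardsC ((fun i : 'I_n => sg i j) @: U)) addKn.
apply: eq_card => k; rewrite unfold_in /available mj !inE /=.
case: imsetP => [[i iU ->] | nim] /=.
  by apply/forallP => /(_ i); rewrite eqxx; move: iU; rewrite inE => ->.
apply/forallP => i; apply/implyP => iU; apply: contra_not_neq nim => <-.
by exists i => //; rewrite inE.
Qed.

(** Each earlier row uses the symbol [k] once, and in different columns. Together with the row
    degrees this makes the available relation regular of degree n - m. *)
Lemma col_deg_available (m : 'I_n) sg k : sg \in column_proper all_cells m ->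
  (\sum_j available all_cells m sg j k)%N = (n - m)%N.
Proof.
move=> /column_properP[_ prop].
pose U := [set i : 'I_n | (i < m)%N].
have U_inj : {in U &, injective (fun i : 'I_n => (sg i)^-1%g k)}.
  move=> i i'; rewrite !inE => im i'm eq_sg; apply/val_inj.
  have sgk : sg i ((sg i)^-1%g k) = sg i' ((sg i)^-1%g k) by rewrite {2}eq_sg !permKV.
  case: (ltngtP i i') => // lt.
    by have := prop i i' ((sg i)^-1%g k) lt i'm (finset.in_setT _) (finset.in_setT _);
      rewrite sgk eqxx.
  by have := prop i' i ((sg i)^-1%g k) lt im (finset.in_setT _) (finset.in_setT _);
    rewrite sgk eqxx.
rewrite -(card_ltn_ord (ltnW (ltn_ord m))) -/U -(card_in_imset U_inj).
rewrite -[X in (X - _)%N]card_ord -(cardsC ((fun i : 'I_n => (sg i)^-1%g k) @: U)) addKn.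
rewrite -sum1_card [RHS]big_mkcond/=; apply: eq_bigr => j _; rewrite /available !inE /=.
case: imsetP => [[i im ->] | nim] /=.
  move: im; rewrite inE => im; case: forallP => // /(_ i); rewrite im finset.in_setT permKV eqxx.
  by [].
case: forallP => // nav; case: nav => i; apply/implyP => /andP[im _].
apply: contra_not_neq nim => <-; exists i; first by rewrite inE.
by rewrite permK.
Qed.

End RowPermutations.

(** * Lower and upper bounds for the number of column-proper arrays *)

Section CountColumnProper.
Variables (R : realType) (n : nat).
Local Notation all_cells := [set: 'I_n * 'I_n]%SET.
Implicit Types (S : {set 'I_n * 'I_n}).

Lemma column_proper0 S : [ffun=> 1%g] \in column_proper S 0.
Proof. by apply/column_properP; split => [i|//]; rewrite ffunE. Qed.

Lemma filled_above_all (m : nat) j : (m <= n)%N -> filled_above all_cells m j = m.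
Proof.
move=> mn; rewrite -[RHS](card_ltn_ord mn); apply: eq_card => i.
by rewrite !inE andbT.
Qed.

Lemma card_column_proper_ge m : (m <= n)%N ->
  \prod_(i < m) (expR (- n%:R) * (n - i)%:R ^+ n) <=
  #|column_proper all_cells m|%:R :> R.
Proof.
elim: m => [_|m IHm mn].
  rewrite big_ord0 ler1n card_gt0; apply/set0Pn.
  by exists [ffun=> 1%g]; exact: column_proper0.
rewrite big_ord_recr/= (card_column_properS _ (Ordinal mn)) natr_sum.
apply: le_trans (_ : _ <= \sum_(sg in column_proper all_cells m)
    expR (- n%:R) * (n - m)%:R ^+ n) _.
  rewrite sumr_const -[leRHS]mulr_natl ler_wpM2r ?mulr_ge0 ?expR_ge0 ?exprn_ge0//.
  exact: IHm (ltnW mn).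
apply: ler_sum => sg sgX; apply: count_perms_regular_ge => j.
  by rewrite row_deg_available// inE filled_above_all ?(ltnW mn).
exact: col_deg_available.
Qed.

Lemma card_column_proper_gt0 : (0 < #|column_proper all_cells n|)%N.
Proof.
rewrite -(ltr0n R); apply: lt_le_trans (card_column_proper_ge (leqnn n)).
by apply: prodr_gt0 => i _; rewrite mulr_gt0 ?expR_gt0// exprn_gt0// ltr0n subn_gt0.
Qed.

Lemma ln_card_column_proper_ge :
  n%:R * ln n`!%:R - n%:R ^+ 2 <= ln #|column_proper all_cells n|%:R :> R.
Proof.
have := card_column_proper_ge (leqnn n).
rewrite big_split/= prodr_const card_ord prodrXl -natr_prod -ffact_prod ffactnn.
have f0 : 0 < n`!%:R :> R by rewrite ltr0n fact_gt0.
have lhs0 : 0 < expR (- n%:R) ^+ n * n`!%:R ^+ n :> R.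
  by rewrite mulr_gt0// exprn_gt0// expR_gt0.
move=> le_card; have := le_card; rewrite -ler_ln ?posrE//; last exact: lt_le_trans le_card.
rewrite lnM ?posrE ?exprn_gt0 ?expR_gt0// !lnXn ?expR_gt0// expRK.
rewrite -[(- _) *+ n]mulr_natl -[ln n`!%:R *+ n]mulr_natl mulrN -expr2; lra.
Qed.

Lemma count_perms_le_expR (a : rel 'I_n) :
  (count_perms a)%:R <= expR (\sum_i bregman_weight R (row_deg a i)).
Proof.
have [->|a0] := posnP (count_perms a); first exact: expR_ge0.
by rewrite -[leLHS]lnK ?posrE ?ltr0n// ler_expR bregman.
Qed.

Definition cell_weight S (i j : 'I_n) : R :=
  bregman_weight R (if (i, j) \in S then (n - filled_above S i j)%N else n).

(** The row degrees of [available] depend on the shape [S] but not on the rows already chosen, so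
    Bregman's bound for the next row is uniform and the bounds multiply. *)
Lemma ln_card_column_proper_le S m : (m <= n)%N ->
  ln #|column_proper S m|%:R <=
  \sum_(i < n | (i < m)%N) \sum_j cell_weight S i j.
Proof.
elim: m => [_|m IHm mn].
  rewrite big_pred0// ln_le0// lern1 -(cards1 ([ffun=> 1%g] : {ffun 'I_n -> 'S_n})).
  apply/subset_leq_card/fintype.subsetP => sg /column_properP[sg1 _].
  by rewrite inE; apply/eqP/ffunP => i; rewrite ffunE sg1.
have [->|] := posnP #|column_proper S m.+1|.
  rewrite ln0// sumr_ge0// => i _; rewrite sumr_ge0// => j _.
  exact: bregman_weight_ge0.
pose m' := Ordinal mn; rewrite (card_column_properS _ m') => X0.
have count_le sg : sg \in column_proper S m ->
    (count_perms (available S m' sg))%:R <= expR (\sum_j cell_weight S m' j).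
  move=> sgX; apply: le_trans (count_perms_le_expR _) _; rewrite ler_expR.
  by apply: ler_sum => j _; rewrite row_deg_available.
have sum_le : (\sum_(sg in column_proper S m) count_perms (available S m' sg))%:R <=
    #|column_proper S m|%:R * expR (\sum_j cell_weight S m' j).
  rewrite natr_sum mulr_natl -sumr_const; exact: ler_sum.
have Xm0 : 0 < #|column_proper S m|%:R :> R.
  rewrite ltr0n lt0n; apply: contraTneq X0 => /cards0_eq ->; by rewrite big_set0.
apply: le_trans (_ : _ <= ln (#|column_proper S m|%:R * expR (\sum_j cell_weight S m' j))) _.
  rewrite ler_ln ?posrE ?ltr0n//; exact: mulr_gt0 (expR_gt0 _).
rewrite lnM ?posrE ?expR_gt0// expRK.
rewrite [leRHS](bigD1 m')/= ?ltnSn// [leRHS]addrC lerD2r.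
apply: le_trans (IHm (ltnW mn)) _; rewrite le_eqVlt; apply/orP; left; apply/eqP.
by apply: eq_bigl => i; rewrite -val_eqE/= ltnS; lia.
Qed.

(** Going down column [j] through the cells of [S], the number of cells of [S] above takes the
    values 0, 1, 2, ... once each. *)
Lemma sum_filled_above S (g : nat -> R) j m : (m <= n)%N ->
  \sum_(i < n | (i < m)%N && ((i, j) \in S)) g (filled_above S i j) =
  \sum_(d < filled_above S m j) g d.
Proof.
elim: m => [_|m IHm mn].
  have -> : filled_above S 0 j = 0%N by apply: eq_card0 => i; rewrite inE.
  by rewrite big_ord0 big_pred0.
pose m' := Ordinal mn.
have filledS : filled_above S m.+1 j = (((m', j) \in S) + filled_above S m j)%N.
  rewrite /filled_above (cardsD1 m') !inE ltnSn; congr (_ + _)%N.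
  by apply: eq_card => i; rewrite !inE -val_eqE/=; lia.
have sumE : \sum_(i < n | (i < m)%N && ((i, j) \in S)) g (filled_above S i j) =
    \sum_(i < n | ((i < m.+1)%N && ((i, j) \in S)) && (i != m')) g (filled_above S i j).
  by apply: eq_bigl => i; rewrite -val_eqE/=; lia.
rewrite filledS; case: (boolP ((m', j) \in S)) => mj.
  rewrite add1n big_ord_recr/= -IHm 1?ltnW// sumE (bigD1 m')/= ?ltnSn// addrC.
  by congr (_ + _); apply: eq_bigl => i.
rewrite add0n -IHm 1?ltnW// sumE; apply: eq_bigl => i.
by case: eqVneq => [->|]; rewrite ?andbT// (negbTE mj) andbF.
Qed.

End CountColumnProper.

(** * Latin squares and their uniquely completable subsets *)

Section LatinRows.
Variable n : nat.
Local Notation all_cells := [set: 'I_n * 'I_n]%SET.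
Implicit Types (L : latin_square n) (C : {set triple n}).

Lemma latin_symbolP L i j :
  exists k, forall k', ((i, j, k') \in val L) = (k' == k).
Proof.
have /and3P[/forallP/(_ i)/forallP/(_ j)/cards1P[k kE] _ _] := valP L.
by exists k => k'; have /finset.setP/(_ k') := kE; rewrite !inE.
Qed.

Lemma latin_row_permP L i :
  exists s : 'S_n, forall j k, ((i, j, k) \in val L) = (k == s j).
Proof.
have /fin_all_exists[f fE] := latin_symbolP L i.
suff f_inj : injective f by exists (perm f_inj) => j k; rewrite fE permE.
move=> j j' eqf; have /and3P[_ /forallP/(_ i)/forallP/(_ (f j))/cards1P[j0 j0E] _] := valP L.
have /finset.setP j0P := j0E; have := j0P j; have := j0P j'.
by rewrite !inE !fE eqf !eqxx => /esym/eqP -> /esym/eqP ->.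
Qed.

Lemma latin_rows_exist : exists rows : latin_square n -> {ffun 'I_n -> 'S_n},
  forall L i j k, ((i, j, k) \in val L) = (k == rows L i j).
Proof.
suff rowE L : exists sg : {ffun 'I_n -> 'S_n},
    forall i j k, ((i, j, k) \in val L) = (k == sg i j).
  by have /fin_all_exists[rows rowsE] := rowE; exists rows.
have /fin_all_exists[f fE] := latin_row_permP L.
by exists [ffun i => f i] => i j k; rewrite fE ffunE.
Qed.

Lemma latin_rows_proper (rows : latin_square n -> {ffun 'I_n -> 'S_n}) L (i i' j : 'I_n) :
  (forall L i j k, ((i, j, k) \in val L) = (k == rows L i j)) ->
  rows L i j = rows L i' j -> i = i'.
Proof.
move=> rowsE eqL.
have /and3P[_ _ /forallP/(_ j)/forallP/(_ (rows L i j))/cards1P[i0 i0E]] := valP L.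
have /finset.setP i0P := i0E; have := i0P i; have := i0P i'.
by rewrite !inE !rowsE eqL !eqxx => /esym/eqP -> /esym/eqP ->.
Qed.

Lemma graph_is_latin (sg : {ffun 'I_n -> 'S_n}) : sg \in column_proper all_cells n ->
  is_latin [set t : triple n | t.2 == sg t.1.1 t.1.2].
Proof.
move=> /column_properP[_ prop]; apply/and3P; split;
  apply/forallP => a; apply/forallP => b; apply/cards1P.
- by exists (sg a b); apply/finset.setP => k; rewrite !inE.
- exists ((sg a)^-1%g b); apply/finset.setP => j; rewrite !inE /=.
  by rewrite -[RHS](inj_eq (@perm_inj _ (sg a))) permKV eq_sym.
have f_inj : injective (fun i : 'I_n => sg i a).
  move=> i i' eq_sg; apply/val_inj.
  case: (ltngtP i i') => // lt.
    by have := prop i i' a lt (ltn_ord _); rewrite !inE eq_sg eqxx => /(_ isT isT).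
  by have := prop i' i a lt (ltn_ord _); rewrite !inE eq_sg eqxx => /(_ isT isT).
exists (invF f_inj b); apply/finset.setP => i; rewrite !inE /=.
have /= fK := f_invF f_inj b.
by rewrite -[RHS](inj_eq f_inj)/= fK eq_sym.
Qed.

Lemma card_column_proper_le_latin :
  (#|column_proper all_cells n| <= #|{: latin_square n}|)%N.
Proof.
have [rows rowsE] := latin_rows_exist.
rewrite -cardsT; apply: leq_trans (leq_imset_card rows _).
apply/subset_leq_card/fintype.subsetP => sg sgX; apply/imsetP.
exists (exist (fun L : {set triple n} => is_latin L) _ (graph_is_latin sgX)); first by rewrite inE.
apply/ffunP => i; apply/permP => j.
by apply/eqP; rewrite -rowsE inE.
Qed.

(** Adding further cells of [L] preserves unique completability, so that sets of one common size can
    be chosen for all squares. *)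
Lemma uniquely_completable_extend L C m :
  uniquely_completable L C -> (#|C| <= m <= n ^ 2)%N ->
  exists2 C' : {set triple n}, uniquely_completable L C' & #|C'| = m.
Proof.
move=> ucC /andP[]; elim: m => [|m IHm].
  by rewrite leqn0 => /eqP C0 _; exists C.
rewrite leq_eqVlt => /predU1P[<- _|Cm mn]; first by exists C.
have [C' /and3P[_ sC'L /forallP ucC'] C'm] := IHm Cm (ltnW mn).
have /set0Pn[t] : val L :\: C' != finset.set0.
  by rewrite finset.setD_eq0; apply/negP => /subset_leq_card; rewrite card_latin C'm leqNgt mn.
rewrite inE => /andP[tC' tL]; exists (t |: C'); last by rewrite cardsU1 tC' C'm.
have sL : t |: C' \subset val L by rewrite finset.subUset finset.sub1set tL.
apply/and3P; split => //; first exact: sub_latin_partial sL.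
apply/forallP => L'; apply/implyP; rewrite finset.subUset => /andP[_].
exact/implyP/ucC'.
Qed.

Lemma scs_uniquely_completable L m : (scs L <= m <= n ^ 2)%N ->
  exists2 C : {set triple n}, uniquely_completable L C & #|C| = m.
Proof.
rewrite /scs; case: ex_minnP => s /existsP[C /andP[/minsetP[ucC _] /eqP <-]] _.
exact: uniquely_completable_extend.
Qed.

Definition holes (S : {set 'I_n * 'I_n}) (i : 'I_n) : {set 'I_n} :=
  [set j | (i, j) \notin S].

(** Independent rearrangements of the rows that move only cells outside [S]. *)
Definition hole_perms (S : {set 'I_n * 'I_n}) : {set {ffun 'I_n -> 'S_n}} :=
  [set tau : {ffun 'I_n -> 'S_n} | [forall i, perm_on (holes S i) (tau i)]].

Lemma card_hole_perms S : #|hole_perms S| = (\prod_i (#|holes S i|)`!)%N.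
Proof.
transitivity #|family (fun i : 'I_n => perm_on (holes S i))|.
  by apply: eq_card => tau; rewrite inE; apply/forallP/familyP => tauP i; exact: tauP.
rewrite card_family foldrE big_map enumT.
by apply: eq_bigr => i _; rewrite card_perm.
Qed.

(* A Latin square is recovered from the cells of a uniquely completable subset
   and its rows there, whatever permutations are applied to the other cells. *)
Lemma latin_shapes m : (forall L, scs L <= m)%N -> (m <= n ^ 2)%N ->
  exists D : latin_square n -> {set 'I_n * 'I_n},
    (forall L, #|D L| = m) /\
    (forall S, #|[set L | D L == S]| * \prod_i (#|holes S i|)`! <= #|column_proper S n|)%N.
Proof.
move=> scsm mn; have [rows rowsE] := latin_rows_exist.
have /fin_all_exists[c cE] L : exists C : {set triple n},
    uniquely_completable L C /\ #|C| = m.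
  have [|C ucC Cm] := @scs_uniquely_completable L m; first by rewrite scsm mn.
  by exists C.
have c_sub L t : t \in c L -> t.2 = rows L t.1.1 t.1.2.
  have [/and3P[_ /fintype.subsetP sCL _] _] := cE L.
  by case: t => -[i j] k /sCL; rewrite rowsE => /eqP.
pose D L := [set t.1 | t in c L].
have DP L i j : (i, j) \in D L -> (i, j, rows L i j) \in c L.
  by move=> /imsetP[[[i' j'] k] tC [-> ->]]; rewrite -[rows _ _ _](c_sub L _ tC).
exists D; split => [L|S].
  have [_ <-] := cE L; apply: card_in_imset => -[[i j] k] [[i' j'] k'] /c_sub/= -> /c_sub/= ->.
  by move=> [-> ->].
rewrite -card_hole_perms -cardsX.
(* The product applies the rearrangement first, so every row is still a permutation and the symbols
   in the cells of [S] are unchanged. *)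
pose Phi (p : latin_square n * {ffun 'I_n -> 'S_n}) : {ffun 'I_n -> 'S_n} :=
  [ffun i => (p.2 i * rows p.1 i)%g].
have PhiS L tau i j : tau \in hole_perms S -> (i, j) \in S ->
    Phi (L, tau) i j = rows L i j.
  rewrite inE => /forallP/(_ i) tau_on ij; rewrite ffunE permM (out_perm tau_on)//.
  by rewrite inE negbK.
rewrite -(@card_in_imset _ _ Phi).
  apply/subset_leq_card/fintype.subsetP => sg /imsetP[[L tau]].
  rewrite finset.in_setX => /andP[_ tauS] ->; apply/column_properP; split.
    by move=> i; rewrite leqNgt ltn_ord.
  move=> i i' j ii' _ ij i'j; rewrite !PhiS//.
  by apply: contraTneq ii' => /(latin_rows_proper rowsE) ->; rewrite ltnn.
move=> [L tau] [L' tau']; rewrite !finset.in_setX !inE.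
move=> /andP[/eqP DL tauS] /andP[/eqP DL' tauS'] eqPhi.
have eq_rows i j : (i, j) \in S -> rows L i j = rows L' i j.
  by move=> ij; rewrite -(PhiS L tau)// ?eqPhi ?PhiS// inE.
(* Both squares have shape [S] and agree on it, so [L'] contains the chosen set of [L], which has
   only one completion. *)
have LL' : L' = L.
  have [/and3P[_ _ /forallP/(_ L')/implyP ucL] _] := cE L.
  apply/eqP/ucL/fintype.subsetP => -[[i j] k] tC.
  have ij : (i, j) \in S by rewrite -DL; apply/imsetP; exists (i, j, k).
  by rewrite rowsE -eq_rows//; have /= -> := c_sub _ _ tC.
subst L'; congr (_, _); apply/ffunP => i.
by have /ffunP/(_ i) := eqPhi; rewrite !ffunE => /mulIg.
Qed.

End LatinRows.

(** * Asymptotics *)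

Section Estimates.
Variable R : realType.

Lemma lnS_lnD_ge n : (0 < n)%N -> n.+1%:R^-1 <= ln n.+1%:R - ln n%:R :> R.
Proof.
move=> n0; have n0R : 0 < n%:R :> R by rewrite ltr0n.
have S0R : 0 < n.+1%:R :> R by rewrite ltr0n.
have := @le_ln1Dx R (- n.+1%:R^-1); rewrite ltrN2 invf_lt1// ltr1n ltnS.
move=> /(_ n0); have -> : 1 + - n.+1%:R^-1 = n%:R / n.+1%:R :> R.
  by rewrite -(natr1 n); field; rewrite natr1 gt_eqF.
by rewrite ln_div ?posrE// -opprB lerN2.
Qed.

Lemma lnS_lnD_le n : (0 < n)%N -> ln n.+1%:R - ln n%:R <= n%:R^-1 :> R.
Proof.
move=> n0; have n0R : 0 < n%:R :> R by rewrite ltr0n.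
rewrite -ln_div ?posrE ?ltr0n//.
have -> : n.+1%:R / n%:R = 1 + n%:R^-1 :> R.
  by rewrite -natr1; field; rewrite gt_eqF.
by apply: le_ln1Dx; rewrite (lt_le_trans (ltrN10 _))// invr_ge0 ltW.
Qed.

Lemma ln_factS n : ln (n.+1)`!%:R = ln n.+1%:R + ln n`!%:R :> R.
Proof. by rewrite factS natrM lnM// posrE ltr0n ?fact_gt0. Qed.

Lemma ln_fact_ge n : n%:R * ln n%:R - n%:R <= ln n`!%:R :> R.
Proof.
elim: n => [|n IHn]; first by rewrite mul0r subrr fact0 ln1.
rewrite ln_factS; have [->|n0] := posnP n.
  by rewrite fact0 mulr1n !ln1; lra.
have := lnS_lnD_le n0; rewrite -(@ler_pM2l _ n%:R) ?ltr0n//.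
rewrite divff ?pnatr_eq0 -?lt0n// mulrBr -(natr1 n) mulrDl mul1r.
by move: IHn; rewrite natr1; lra.
Qed.

Lemma ln_fact_le n : (0 < n)%N ->
  ln n`!%:R <= n%:R * ln n%:R - n%:R + 1 + ln n%:R :> R.
Proof.
elim: n => // n IHn _; rewrite ln_factS; have [->|n0] := posnP n.
  by rewrite fact0 mulr1n !ln1; lra.
have := lnS_lnD_ge n0; rewrite -(@ler_pM2l _ n.+1%:R) ?ltr0n//.
rewrite divff ?pnatr_eq0// mulrBr -(natr1 n) !mulrDl !mul1r.
by move: (IHn n0); rewrite natr1; lra.
Qed.

(** Stirling's bound leaves an error (1 + ln n)/n; it is relaxed to 2/sqrt n, whose sum telescopes
    by [inv_sqrt_le]. *)
Lemma bregman_weight_le n : (0 < n)%N ->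
  bregman_weight R n <= ln n%:R - 1 + 2 / Num.sqrt n%:R.
Proof.
move=> n0; have n0R : 0 < n%:R :> R by rewrite ltr0n.
set s := Num.sqrt n%:R; have s0 : 0 < s by rewrite sqrtr_gt0.
have sE : n%:R = s ^+ 2 by rewrite sqr_sqrtr// ltW.
have ln_s : 1 + ln n%:R <= 2 * s.
  have := @le_ln1Dx R (s - 1); rewrite subrKC ltrBrDr addrC subrr => /(_ s0).
  by rewrite sE lnXn// mulr2n; lra.
rewrite /bregman_weight ler_pdivrMr//; apply: le_trans (ln_fact_le n0) _.
have -> : (ln n%:R - 1 + 2 / s) * n%:R = n%:R * ln n%:R - n%:R + 2 * s.
  have sn : 2 / s * n%:R = 2 * s by rewrite sE; field; rewrite gt_eqF.
  by rewrite mulrDl sn; ring.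
by lra.
Qed.

(** With b and a the two roots, b - a = 1/(a + b) >= 1/(2 b). *)
Lemma inv_sqrt_le n : 2 / Num.sqrt n.+1%:R <= 4 * Num.sqrt n.+1%:R - 4 * Num.sqrt n%:R :> R.
Proof.
set b := Num.sqrt n.+1%:R; set a := Num.sqrt n%:R.
have b0 : 0 < b by rewrite sqrtr_gt0 ltr0n.
have a0 : 0 <= a by rewrite sqrtr_ge0.
have bE : b ^+ 2 = n.+1%:R by rewrite sqr_sqrtr.
have aE : a ^+ 2 = n%:R by rewrite sqr_sqrtr.
rewrite ler_pdivrMr//; have : b ^+ 2 = a ^+ 2 + 1 by rewrite bE aE natr1.
by move=> ab; nra.
Qed.

Lemma sum_bregman_weight_le n c : (c <= n)%N ->
  \sum_(d < c) bregman_weight R (n - d) <=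
  ln n`!%:R - ln (n - c)`!%:R - c%:R + 4 * Num.sqrt n%:R - 4 * Num.sqrt (n - c)%:R.
Proof.
elim: c => [_|c IHc cn]; first by rewrite big_ord0 subn0; lra.
rewrite big_ord_recr/= -(natr1 c).
have := IHc (ltnW cn); have -> : (n - c = (n - c.+1).+1)%N by lia.
set D := (n - c.+1)%N; rewrite ln_factS.
have := bregman_weight_le (ltn0Sn D); have := inv_sqrt_le D; lra.
Qed.

(** Combines the bound N^k / k! for the binomial coefficient with k! >= (k/e)^k. *)
Lemma ln_bin_le N k : (0 < k <= N)%N ->
  ln 'C(N, k)%:R <= k%:R + k%:R * ln N%:R - k%:R * ln k%:R :> R.
Proof.
move=> /andP[k0 kN].
have : (k`! * 'C(N, k) <= N ^ k)%N.
  rewrite mulnC bin_ffact ffact_prod -[X in (_ <= _ ^ X)%N]card_ord -prod_nat_const.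
  by apply: leq_prod => i _; exact: leq_subr.
have C0 : 0 < 'C(N, k)%:R :> R by rewrite ltr0n bin_gt0.
have f0 : 0 < k`!%:R :> R by rewrite ltr0n fact_gt0.
have N0 : 0 < N%:R :> R by rewrite ltr0n (leq_trans k0).
rewrite -(ler_nat R) natrM natrX => le_pow.
have : ln (k`!%:R * 'C(N, k)%:R) <= ln (N%:R ^+ k) :> R.
  by rewrite ler_ln// posrE ?exprn_gt0// mulr_gt0.
by rewrite lnM ?posrE// lnXn// -[_ *+ k]mulr_natl; have := ln_fact_ge k; lra.
Qed.

(** By Stirling and convexity of x ln x, the sum is bounded below by its estimate for equal parts k
    / #|I|. *)
Lemma sum_ln_fact_ge (I : finType) (h : I -> nat) k : (0 < k)%N -> (\sum_i h i = k)%N ->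
  k%:R * ln k%:R - k%:R * ln #|I|%:R - k%:R <= \sum_i ln (h i)`!%:R :> R.
Proof.
move=> k0 hk; have I0 : (0 < #|I|)%N.
  rewrite lt0n; apply: contraTneq k0 => /card0_eq I0.
  by rewrite -hk big_pred0.
have k0R : 0 < k%:R :> R by rewrite ltr0n.
have I0R : 0 < #|I|%:R :> R by rewrite ltr0n.
have hkR : \sum_i (h i)%:R = k%:R :> R by rewrite -natr_sum hk.
have : \sum_i ((h i)%:R - k%:R / #|I|%:R) <=
    \sum_i ((h i)%:R * ln (h i)%:R - (h i)%:R * ln (k%:R / #|I|%:R)) :> R.
  by apply: ler_sum => i _; apply: xlnx_tangent => //; exact: divr_gt0.
have muE : \sum_(i : I) k%:R / #|I|%:R = k%:R :> R.
  by rewrite sumr_const -[LHS]mulr_natr divfK ?gt_eqF.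
rewrite !sumrB muE -mulr_suml hkR subrr.
rewrite ln_div ?posrE// mulrBr.
have : \sum_i ((h i)%:R * ln (h i)%:R - (h i)%:R) <= \sum_i ln (h i)`!%:R :> R.
  by apply: ler_sum => i _; exact: ln_fact_ge.
by rewrite sumrB hkR; lra.
Qed.

End Estimates.

(** * Arrays of a fixed shape with k holes *)

Section ShapeBound.
Variables (R : realType) (n k : nat).
Hypotheses (k_gt0 : (0 < k)%N) (k_le : (k <= n ^ 2)%N).
Variable S : {set 'I_n * 'I_n}.
Hypothesis cardS : #|S| = (n ^ 2 - k)%N.

Let column_holes (j : 'I_n) : nat := #|[set i | (i, j) \notin S]|.


Lemma card_shapeC : #|~: S| = k.
Proof.
have := cardsC S; rewrite card_prod card_ord cardS mulnn => H.
by apply/eqP; rewrite -(eqn_add2l (n ^ 2 - k)) H subnK.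
Qed.

Lemma sum_card_holes : (\sum_i #|holes S i| = k)%N.
Proof.
rewrite -card_shapeC -sum1_card (eq_bigl (fun p => (p.1, p.2) \in ~: S)) => [|[]//].
rewrite -(pair_big_dep predT (fun i j => (i, j) \in ~: S) (fun _ _ => 1%N))/=.
apply: eq_bigr => i _; rewrite sum1dep_card; apply: eq_card => j.
by rewrite !inE.
Qed.

Lemma sum_column_holes : (\sum_j column_holes j = k)%N.
Proof.
rewrite -card_shapeC -sum1_card (eq_bigl (fun p => (p.1, p.2) \in ~: S)) => [|[]//].
rewrite -(pair_big_dep predT (fun i j => (i, j) \in ~: S) (fun _ _ => 1%N))/=.
rewrite (exchange_big_dep predT)//=.
apply: eq_bigr => j _; rewrite sum1dep_card; apply: eq_card => i.
by rewrite !inE.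
Qed.

Lemma column_holes_le j : (column_holes j <= n)%N.
Proof. by rewrite -[leqRHS]card_ord max_card. Qed.

Lemma filled_above_full j : filled_above S n j = (n - column_holes j)%N.
Proof.
rewrite -[X in (X - _)%N]card_ord -(cardsC [set i | (i, j) \notin S]) addKn.
by apply: eq_card => i; rewrite !inE ltn_ord negbK.
Qed.

Lemma shape_order_gt0 : (0 < n)%N.
Proof. by rewrite lt0n; apply: contraTneq k_le => ->; rewrite -ltnNge. Qed.

(** The cells of [S] in the column have degrees n, n - 1, ..., down to one more than the number of
    holes, which telescopes to a quotient of factorials; each hole has degree n. *)
Lemma column_weight_le j :
  \sum_i cell_weight R S i j <=
  ln n`!%:R - ln (column_holes j)`!%:R - n%:R + (column_holes j)%:R
  + 4 * Num.sqrt n%:R + (column_holes j)%:R * (ln n%:R - 1 + 2 / Num.sqrt n%:R).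
Proof.
rewrite (bigID (fun i => (i, j) \in S))/=.
have -> : \sum_(i | (i, j) \in S) cell_weight R S i j =
    \sum_(d < n - column_holes j) bregman_weight R (n - d).
  rewrite -filled_above_full -(sum_filled_above S (fun d => bregman_weight R (n - d)) j (leqnn n)).
  apply: eq_big => [i|i ij]; first by rewrite ltn_ord.
  by rewrite /cell_weight ij.
have -> : \sum_(i | (i, j) \notin S) cell_weight R S i j =
    (column_holes j)%:R * bregman_weight R n.
  rewrite (eq_bigr (fun=> bregman_weight R n)) => [|i /negbTE ij]; last first.
    by rewrite /cell_weight ij.
  by rewrite sumr_const mulr_natl /column_holes cardsE.
have := sum_bregman_weight_le R (leq_subr (column_holes j) n).
rewrite subKn ?column_holes_le// natrB ?column_holes_le//.
have := ler_wpM2l (ler0n R (column_holes j)) (bregman_weight_le R shape_order_gt0).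
have := sqrtr_ge0 ((column_holes j)%:R : R); lra.
Qed.

(** The factorials of the hole counts enter twice, by columns through Bregman and by rows through
    the rearrangements; each time they yield k ln k - k ln n - k. The errors are 4 n^(3/2) from the
    columns and 2 k / sqrt n <= 2 n^(3/2) from the holes. *)
Lemma ln_shape_le :
  ln #|column_proper S n|%:R - \sum_i ln (#|holes S i|)`!%:R <=
  n%:R * ln n`!%:R - n%:R ^+ 2 + 2 * k%:R + k%:R * ln n%:R
    - 2 * (k%:R * ln k%:R - k%:R * ln n%:R) + 6 * (n%:R * Num.sqrt n%:R) :> R.
Proof.
have := ln_card_column_proper_le R S (leqnn n).
rewrite (eq_bigl xpredT) => [|i]; last by rewrite ltn_ord.
rewrite exchange_big/= => lnX.
have sum_col : \sum_j \sum_i cell_weight R S i j <= n%:R * ln n`!%:R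
    - \sum_j ln (column_holes j)`!%:R - n%:R ^+ 2 + k%:R
    + 4 * (n%:R * Num.sqrt n%:R) + k%:R * (ln n%:R - 1 + 2 / Num.sqrt n%:R).
  apply: le_trans (ler_sum _ (fun j _ => column_weight_le j)) _.
  have const (c : R) : \sum_(j < n) c = n%:R * c by rewrite sumr_const card_ord mulr_natl.
  rewrite !big_split/= !sumrN !const -mulr_suml -natr_sum sum_column_holes.
  by rewrite expr2 mulrCA.
have row_fact := sum_ln_fact_ge R k_gt0 sum_card_holes.
have col_fact := sum_ln_fact_ge R k_gt0 sum_column_holes.
rewrite !card_ord in row_fact col_fact.
have sqrt0 : 0 < Num.sqrt n%:R :> R by rewrite sqrtr_gt0 ltr0n shape_order_gt0.
have k_sqrt : k%:R * (2 / Num.sqrt n%:R) <= 2 * (n%:R * Num.sqrt n%:R) :> R.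
  rewrite mulrA ler_pdivrMr// -!mulrA -expr2 sqr_sqrtr// -expr2 mulrC.
  by rewrite ler_wpM2l// -natrX ler_nat.
by move: lnX sum_col; rewrite mulrDr mulrBr; lra.
Qed.

End ShapeBound.

(** * Comparison of the two counts and conclusion *)

Theorem latin_scs_bound (R : realType) n k : (0 < k)%N -> (k <= n ^ 2)%N ->
  (forall L : latin_square n, (scs L + k <= n ^ 2)%N) ->
  k%:R * (ln k%:R - (5 / 3) * ln n%:R - 1) <= 2 * (n%:R * Num.sqrt n%:R) :> R.
Proof.
move=> k0 kn scsk; have n0 := shape_order_gt0 k0 kn.
have scs_le (L : latin_square n) : (scs L <= n ^ 2 - k)%N by have := scsk L; lia.
have [D [Dcard Dcount]] := latin_shapes scs_le (leq_subr _ _).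
pose B : R := n%:R * ln n`!%:R - n%:R ^+ 2 + 2 * k%:R + k%:R * ln n%:R
    - 2 * (k%:R * ln k%:R - k%:R * ln n%:R) + 6 * (n%:R * Num.sqrt n%:R).
have shape_le (S : {set 'I_n * 'I_n}) : #|S| = (n ^ 2 - k)%N ->
    #|[set L | D L == S]|%:R <= expR B.
  move=> cardS; have := Dcount S.
  set F := (\prod_i _)%N; have F0 : (0 < F)%N by rewrite prodn_gt0// => i; exact: fact_gt0.
  have [->|] := posnP #|[set L | D L == S]|; first by rewrite expR_ge0.
  set l := #|_| => l0 lF; rewrite -[leLHS]lnK ?posrE ?ltr0n// ler_expR.
  apply: le_trans (ln_shape_le R k0 kn cardS).
  rewrite lerBrDr; apply: le_trans (_ : _ <= ln (l * F)%:R) _.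
    by rewrite natrM lnM ?posrE ?ltr0n// lerD2l /F natr_prod prod_expR_ln ?expRK.
  have lF0 : (0 < l * F)%N by rewrite muln_gt0 l0.
  by rewrite ler_ln ?posrE ?ltr0n ?ler_nat// (leq_trans lF0).
have latin_le : #|{: latin_square n}|%:R <= 'C(n ^ 2, k)%:R * expR B.
  rewrite -sum1_card (partition_big D (fun S : {set 'I_n * 'I_n} => #|S| == n ^ 2 - k)%N)
    => [|L _]; last first.
    by rewrite Dcard.
  have -> : 'C(n ^ 2, k) = #|[set S : {set 'I_n * 'I_n} | #|S| == n ^ 2 - k]%N|.
    by rewrite card_draws card_prod card_ord mulnn bin_sub.
  rewrite natr_sum mulr_natl -sumr_const.
  rewrite [leRHS](eq_bigl (fun S : {set 'I_n * 'I_n} => #|S| == n ^ 2 - k)%N).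
    by apply: ler_sum => S /eqP/shape_le; rewrite sum1dep_card.
  by move=> S; rewrite inE.
have latin0 : (0 < #|{: latin_square n}|)%N.
  exact: leq_trans (card_column_proper_gt0 R n) (card_column_proper_le_latin n).
have bin0 : 0 < 'C(n ^ 2, k)%:R :> R by rewrite ltr0n bin_gt0.
have ln_latin : ln #|{: latin_square n}|%:R <= ln 'C(n ^ 2, k)%:R + B.
  rewrite -[B]expRK -lnM ?posrE ?expR_gt0// ler_ln ?posrE ?ltr0n//.
  by rewrite mulr_gt0// expR_gt0.
have ln_X : ln #|column_proper [set: 'I_n * 'I_n]%SET n|%:R <= ln #|{: latin_square n}|%:R :> R.
  by rewrite ler_ln ?posrE ?ltr0n ?(card_column_proper_gt0 R)// ler_nat card_column_proper_le_latin.
have k01 : (0 < k <= n ^ 2)%N by rewrite k0.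
(* After cancelling n ln n! - n^2, the bounds give 3 k ln k - 5 k ln n - 3 k <= 6 n^(3/2): one k ln
   k comes from the choice of the shape and two from the holes. *)
have := ln_bin_le R k01; rewrite natrX lnXn ?ltr0n// mulr2n.
have := ln_card_column_proper_ge R n; rewrite /B in ln_latin.
rewrite !mulrBr mulrDr; lra.
Qed.

Lemma eventually_scs (R : realType) (e : R) : 0 < e ->
  \forall n \near \oo%classic,
    n%:R ^+ 2 - (\max_(L : latin_square n) scs L)%N%:R <=
    (expR 1 + e) * n%:R `^ (5 / 3) :> R.
Proof.
move=> e0; pose c := ln (expR 1 + e) - 1.
have ee0 : 0 < expR 1 + e by rewrite addr_gt0 ?expR_gt0.
have c0 : 0 < c by rewrite subr_gt0 -[X in X < _]expRK ltr_ln ?posrE ?expR_gt0 ?ltrDl.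
near=> n.
(* The bound would force c n^(5/3) <= 2 n^(3/2), that is n <= (2/c)^6. *)
have n_big : expR (6 * (ln 2 - ln c)) < n%:R by near: n; exact: nbhs_infty_gtr.
have n0 : 0 < n%:R :> R by exact: lt_trans (expR_gt0 _) n_big.
set M := (\max_(L : latin_square n) scs L)%N; rewrite leNgt; apply/negP => lt_k.
set x := n%:R `^ (5 / 3) in lt_k; have x0 : 0 < x by rewrite powR_gt0.
have Mn : (M <= n ^ 2)%N.
  rewrite -(ler_nat R) natrX -subr_ge0; apply/ltW/(lt_trans _ lt_k).
  exact: mulr_gt0.
pose k := (n ^ 2 - M)%N.
have kE : k%:R = n%:R ^+ 2 - M%:R :> R by rewrite natrB// natrX.
have k_gt : (expR 1 + e) * x < k%:R by rewrite kE.
have k0 : 0 < k%:R :> R by exact: lt_trans (mulr_gt0 ee0 x0) k_gt.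
have := @latin_scs_bound R n k; rewrite -(ltr0n R) => /(_ k0 (leq_subr _ _)).
have scsk (L : latin_square n) : (scs L + k <= n ^ 2)%N.
  have : (scs L <= M)%N by exact: bigop.leq_bigmax.
  by rewrite /k; lia.
move=> /(_ scsk).
have ln_k : c <= ln k%:R - 5 / 3 * ln n%:R - 1.
  have : ln ((expR 1 + e) * x) <= ln k%:R by rewrite ler_ln ?posrE ?mulr_gt0// ltW.
  by rewrite lnM ?posrE// /x ln_powR /c; lra.
have x_le_k : x <= k%:R.
  apply: le_trans (ltW k_gt); rewrite ler_peMl ?ltW//.
  by have := expR_ge1Dx (1 : R); lra.
have : x * c <= k%:R * (ln k%:R - 5 / 3 * ln n%:R - 1).
  by apply: ler_pM; rewrite // ltW.
move=> /le_trans /[apply].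
have s0 : 0 < Num.sqrt n%:R :> R by rewrite sqrtr_gt0.
rewrite -ler_ln ?posrE ?mulr_gt0// !lnM ?posrE ?mulr_gt0// /x ln_powR.
have ln_n : ln n%:R = ln (Num.sqrt n%:R) *+ 2 :> R by rewrite -lnXn// sqr_sqrtr// ltW.
move: n_big; rewrite -ltr_ln ?posrE ?expR_gt0// expRK.
rewrite ln_n mulr2n; lra.
Unshelve. all: by end_near. Qed.

Unset Implicit Arguments.

Local Open Scope classical_set_scope.
Local Open Scope ring_scope.

Theorem theorem4 (R : realType) :
  exists f : nat -> R,
    f n @[n --> \oo] --> (0 : R) /\
    forall n : nat, (0 < n)%N ->
      exists L : latin_square n,
        n%:R ^+ 2 - (expR 1 + f n) * n%:R `^ (5 / 3) <= (scs L)%:R.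
Proof.
pose M n : R := (\max_(L : latin_square n) scs L)%N%:R.
(* The exact excess over e for the best square of order n, so the inequality holds for every n > 0.
   Truncation at 0 reduces convergence to the upper bound of [eventually_scs]. *)
pose f n : R := Num.max 0 ((n%:R ^+ 2 - M n) / n%:R `^ (5 / 3) - expR 1).
have pow0 n : (0 < n)%N -> 0 < n%:R `^ (5 / 3) :> R.
  by move=> n0; apply: powR_gt0; rewrite ltr0n.
exists f; split => [|n n0].
  apply/cvgrPdist_le => e e0; near=> n.
  have n0 : (0 < n)%N by near: n; exact: nbhs_infty_gt.
  rewrite sub0r normrN ger0_norm ?le_max ?lexx// ge_max ltW//= lerBlDl.
  by rewrite ler_pdivrMr ?pow0//; near: n; exact: eventually_scs.
have latin0 : (0 < #|{: latin_square n}|)%N.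
  exact: leq_trans (card_column_proper_gt0 R n) (card_column_proper_le_latin n).
have [L LM] := bigop.eq_bigmax (@scs n) latin0.
exists L; rewrite -LM -/(M n) lerBlDl -lerBlDr -ler_pdivrMr ?pow0// -lerBlDl.
by rewrite le_max lexx orbT.
Unshelve. all: by end_near. Qed.
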